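(* There are positive constants $C_0,C_2,C_3$ such that the following holds. Let $m,n$ be integers satisfying $C_0\le n<m<2n$ and let $\delta=n/m$. Let $r>m$ be an integer with $r\ge\left(\frac{1}{1-\delta}\right)^{C_2}n$. Then $$\chi^n(m,r)\ \ge\ \frac{1}{C_3}\,n(\ln(n))^2\,\ln\!\left(\frac{1}{1-\delta}\right).$$
   Context: Interval notation denotes sets of integers. For a finite set $Y$ of integers (''keys''), a storage function for $Y$ is a strictly order preserving map $f:Y\to[1,m]$ ($x<y$ implies $f(x)<f(y)$); $[1,m]$ is the set of cells of an array of size $m$. The online labeling (array loading) game $G^n(m,r)$, for integers $n\le m<r$, is played by an adversary and a (deterministic) algorithm in $n$ steps. At step $t\in[1,n]$ the adversary selects a key $y^t\in\{1,\dots,r\}\setminus\{y^1,\dots,y^{t-1}\}$, and the algorithm, before seeing later keys, responds with a storage function $f^t$ for the set $Y^t=\{y^1,\dots,y^t\}$. A key $y\in Y^t$ is relocated at step $t$ if $y=y^t$ or $f^t(y)\ne f^{t-1}(y)$; $Rel^t$ is the set of keys relocated at step $t$. The total cost is $\chi^n=\sum_{t=1}^n|Rel^t|$. The algorithm wants to minimize and the adversary to maximize this cost. $\chi^n(m,r)$ denotes the smallest cost that can be achieved by the algorithm against the best adversary, i.e. the minimum over algorithms of the maximum over adversary key sequences of the total cost. *)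

(* Defs.v *)
From mathcomp Require Import all_boot all_order all_algebra.
From mathcomp Require Import all_classical all_reals all_analysis.

Set Implicit Arguments.
Unset Strict Implicit.
Unset Printing Implicit Defensive.

Local Open Scope nat_scope.

(* The keys 1, ..., r and the cells 1, ..., m are represented
   by the ordinals 'I_r and 'I_m, i.e. both are shifted by one; only their order
   matters. *)

(* A storage function is defined on Y only; here it is a total function whose
   values outside Y are irrelevant. *)
Definition storage_fun (r m : nat) (Y : seq 'I_r) (f : 'I_r -> 'I_m) : Prop :=
  forall x y : 'I_r, x \in Y -> y \in Y -> x < y -> f x < f y.

(* A deterministic algorithm maps the history y^1, ..., y^t of the keys selected
   so far to the storage function f^t; its own earlier answers are determined by
   the prefixes of that history. *)
Definition algorithm (r m : nat) : Type := seq 'I_r -> 'I_r -> 'I_m.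

Definition valid_algorithm (n r m : nat) (A : algorithm r m) : Prop :=
  forall h : seq 'I_r, uniq h -> size h <= n -> storage_fun h (A h).

(* The set Rel^(t+1): steps are counted from 0, so that the key of step t is
   tnth y t and the history after step t is take t.+1 y. *)
Definition relocated (n r m : nat) (A : algorithm r m) (y : n.-tuple 'I_r)
    (t : 'I_n) : {set 'I_r} :=
  [set k in take t.+1 y
     | (k == tnth y t) || (A (take t.+1 y) k != A (take t y) k)].

Definition total_cost (n r m : nat) (A : algorithm r m) (y : n.-tuple 'I_r)
    : nat :=
  \sum_(t < n) #|relocated A y t|.

Definition worst_cost (n r m : nat) (A : algorithm r m) : nat :=
  \max_(y : n.-tuple 'I_r | uniq y) total_cost A y.

Definition is_min_cost (n m r c : nat) : Prop :=
  (exists2 A : algorithm r m, valid_algorithm n A & worst_cost n A = c) /\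
  (forall A : algorithm r m, valid_algorithm n A -> c <= worst_cost n A).

(* The default value 0 is never used when 0 < n <= m, see chiP. *)
Definition chi (n m r : nat) : nat := xget 0 [set c | is_min_cost n m r c]%classic.

Lemma valid_algorithm_exists (n m r : nat) :
  0 < n <= m -> exists A : algorithm r m, valid_algorithm n A.
Proof.
case: m => [|m] /andP[n0 nm]; first by rewrite leqNgt n0 in nm.
have lt_count (h : seq 'I_r) (x : 'I_r) (P Q : pred 'I_r) :
    x \in h -> ~~ P x -> Q x -> subpred P Q -> count P h < count Q h.
  move=> xh nPx Qx PQ; elim: h xh => //= z h IH.
  rewrite inE => /orP[/eqP <-|/IH xh].
    by rewrite (negbTE nPx) Qx ltnS (sub_count PQ).
  rewrite -addnS leq_add //.
  by have := PQ z; case: (P z) => // ->.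
exists (fun h y => inord (count (fun x : 'I_r => x < y) h)).
move=> h _ hn x y xh yh xy.
have bound z : z \in h -> count (fun x : 'I_r => x < z) h < m.+1.
  move=> zh; apply: leq_trans (leq_trans hn nm).
  by rewrite -(count_predT h); apply: (lt_count _ z) => //=; rewrite ltnn.
rewrite !inordK ?bound //.
apply: (lt_count _ x) => //=; first by rewrite ltnn.
by move=> z /= /ltn_trans; apply.
Qed.

Lemma chiP (n m r : nat) : 0 < n <= m -> is_min_cost n m r (chi n m r).
Proof.
move=> nm; have [A vA] := valid_algorithm_exists r nm.
pose P c := `[< exists2 B : algorithm r m, valid_algorithm n B
                  & worst_cost n B = c >].
have exP : exists c, P c by exists (worst_cost n A); apply/asboolP; exists A.
have [c /asboolP Pc minc] := ex_minnP exP.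
apply: (@xgetPex _ 0 [set c | is_min_cost n m r c]%classic).
exists c; split=> // B vB; apply: minc.
by apply/asboolP; exists B.
Qed.

(* Main.v *)
(** At the price of no extra cost, the algorithm may be assumed to be lazy: an
    insertion moves a set of consecutive keys around the new one.  The sparsity
    of an interval of keys is its width in cells divided by the number of its
    keys, corrected by a multiple of the number of integers it spans so that
    intervals of small sparsity still contain unused keys.

    The adversary keeps a chain of nested intervals of keys, the levels, each at
    most half as large as the previous one and hardly sparser, and inserts into
    the innermost.  A level is born balanced: no short prefix or suffix of the
    surrounding interval is noticeably less sparse than the whole.  Hence,
    when the algorithm moves the ends of a level, the level can be extended up to
    the next unmoved keys without getting much sparser; it dies when a constant
    fraction of its keys has been absorbed in this way, and these moves pay for
    it.  An unbalanced interval is replaced by a piece that is less sparse.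

    The sparsity can decrease by at most [bud], the proportion of free cells up
    to a constant, along the whole chain, and it decreases with every insertion.
    So there are about [ln m] levels at any time, most of them received few
    insertions relative to their size, and an insertion costs
    [(ln m) ^ 2 / bud] on average.  Filling a third of the free cells thus
    costs [m (ln m) ^ 2], and [ln (1 / (1 - delta))] such phases fit into
    the game. *)

Require Import Defs.
From mathcomp Require Import all_boot all_order all_algebra.
From mathcomp Require Import all_classical all_reals all_analysis.
From mathcomp Require Import zify ring lra.

Set Implicit Arguments.
Unset Strict Implicit.
Unset Printing Implicit Defensive.

Import Order.TTheory GRing.Theory Num.Theory.
Local Open Scope nat_scope.

(** * Counting keys in half-open intervals *)

Definition cnt (h : seq nat) (a b : nat) : nat := count (fun k => a < k <= b) h.

Arguments cnt : simpl never.

Lemma cnt_split h a b c : a <= b -> b <= c -> cnt h a c = cnt h a b + cnt h b c.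
Proof.
move=> ab bc; rewrite /cnt; elim: h => //= k h ->.
by case: (leqP k b) => /= kb; lia.
Qed.

Lemma cnt_cons y h a b : cnt (y :: h) a b = (a < y <= b) + cnt h a b.
Proof. by []. Qed.

Lemma cntxx h a : cnt h a a = 0.
Proof. by rewrite /cnt; elim: h => //= k h ->; lia. Qed.

Lemma cnt_recr h a b : uniq h -> a <= b -> cnt h a b.+1 = cnt h a b + (b.+1 \in h).
Proof.
move=> uh ab; rewrite -(count_uniq_mem b.+1 uh) /cnt.
elim: h {uh} => //= k h ->.
by case: (eqVneq k b.+1) => [->|/eqP kb] /=; lia.
Qed.

Lemma cnt_gt0 h a b : a < b -> b \in h -> 0 < cnt h a b.
Proof. by move=> ab bh; rewrite -has_count; apply/hasP; exists b; rewrite ?ab ?leqnn. Qed.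

Lemma cnt_lt h a b : 0 < cnt h a b -> a < b.
Proof. by rewrite -has_count => /hasP[k _ /andP[ak kb]]; apply: leq_trans kb. Qed.

(** The keys of [(a, b]] occupy distinct cells of [(f a, f b]]. *)
Lemma cnt_le_strict h a b (f : nat -> nat) : uniq h ->
    (forall x y, x \in h -> y \in h -> x < y -> f x < f y) ->
    a \in h -> b \in h -> a <= b -> f a + cnt h a b <= f b.
Proof.
move=> uh fm ah bh; rewrite leq_eqVlt => /predU1P[<-|ab]; first by rewrite cntxx addn0.
have fab := fm _ _ ah bh ab.
suff: cnt h a b <= size (iota (f a).+1 (f b - f a)) by rewrite size_iota; lia.
rewrite /cnt -size_filter -(size_map f); apply: uniq_leq_size.
  rewrite map_inj_in_uniq ?filter_uniq// => x y.
  rewrite !mem_filter => /andP[_ xh] /andP[_ yh] fxy.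
  by case: (ltngtP x y) => // /fm -/(_ _ _)/wrap[]//; rewrite fxy ltnn.
move=> z /mapP[x]; rewrite mem_filter => /andP[/andP[ax xb] xh] ->.
rewrite mem_iota; have := fm _ _ ah xh ax.
move: xb; rewrite leq_eqVlt => /predU1P[->|/(fm _ _ xh bh)]; lia.
Qed.

(** A discrete intermediate value theorem: from one integer to the next the count grows by at most
    one, and only at keys. *)
Lemma rank_ex h a b j : uniq h -> a \in h -> a <= b -> j <= cnt h a b ->
  exists x, [/\ x \in h, a <= x, x <= b & cnt h a x = j].
Proof.
move=> uh ah; elim: b => [|b IH] ab jc.
  have a0 : a = 0 by lia.
  by exists a; split; rewrite ?a0 // -?a0 ?cntxx //; move: jc; rewrite a0 cntxx; lia.
case: (leqP a b) => [ab'|ba]; last first.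
  have e : a = b.+1 by lia.
  by move: jc; rewrite -e cntxx leqn0 => /eqP ->; exists a; rewrite cntxx.
case: (leqP j (cnt h a b)) => [/(IH ab')[x [xh ax xb xj]]|jlt].
  by exists x; split => //; lia.
have := cnt_recr uh ab' => e; exists b.+1; split; try lia.
by case: (boolP (b.+1 \in h)) => // bh; move: e jc jlt; rewrite (negbTE bh); lia.
Qed.

Lemma cnt_shift h a b : uniq h -> a \in h -> b \in h -> a <= b ->
  count (fun k => a <= k < b) h = cnt h a b.
Proof.
move=> uh ah bh ab.
have : count (fun k => a <= k < b) h + count_mem b h = count_mem a h + cnt h a b :> nat.
  by rewrite /cnt; elim: h {uh ah bh} => //= k h; lia.
by rewrite !count_uniq_mem// ah bh; lia.
Qed.

(** The next unmoved key, up to which a level will be extended. *)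
Lemma unmoved_left (h : seq nat) (mv : pred nat) a b : a \in h -> a <= b -> ~~ mv a ->
  exists x, [/\ x \in h, a <= x, x <= b, ~~ mv x &
    forall k, k \in h -> x < k <= b -> mv k].
Proof.
move=> ah + na; elim: b => [|b IH] ab.
  by exists a; split => // k _; lia.
case: (leqP a b) => [ab'|ba]; last by exists a; split => // k _; lia.
have [x [xh ax xb nx mx]] := IH ab'.
case: (boolP ((b.+1 \in h) && ~~ mv b.+1)) => [/andP[bh nb]|nb].
  by exists b.+1; split => //; lia.
exists x; split => //; first lia.
move=> k kh /andP[xk kb]; case: (eqVneq k b.+1) => [e|/eqP ne]; last by apply: mx => //; lia.
by move: nb; rewrite -e kh negbK.
Qed.

Lemma unmoved_right (h : seq nat) (mv : pred nat) a b : b \in h -> a <= b -> ~~ mv b ->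
  exists x, [/\ x \in h, a <= x, x <= b, ~~ mv x &
    forall k, k \in h -> a <= k < x -> mv k].
Proof.
move=> bh ab nb.
have ex : exists x, [&& x \in h, a <= x & ~~ mv x] by exists b; rewrite bh ab.
have [x /and3P[xh ax nx] xmin] := ex_minnP ex.
exists x; split => //; first by apply: xmin; rewrite bh ab.
move=> k kh /andP[ak kx]; apply/negPn/negP => nk.
by have := xmin k; rewrite kh ak nk => /(_ isT); lia.
Qed.

(** Follow the keys upwards from [a]: as long as every successor is a key, the interval is full. *)
Lemma free_key_ex h (a b : nat) : uniq h -> a \in h -> cnt h a b < b - a ->
  exists p, [/\ p \in h, a <= p, p < b & p.+1 \notin h].
Proof.
move=> uh ah lt.
suff : a <= b -> (exists p, [/\ p \in h, a <= p, p < b & p.+1 \notin h])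
    \/ (b \in h /\ cnt h a b = b - a).
  by case=> [|//|[_]]; lia.
elim: b {lt} => [|b IH] ab.
  by right; have -> : 0 = a; [lia|rewrite ah cntxx subnn].
have [ab'|ba] := leqP a b; last first.
  by have -> : b.+1 = a; [lia|right; rewrite ah cntxx subnn].
have [[p [? ? ? ?]]|[bh cb]] := IH ab'; first by left; exists p; split => //; lia.
have [bh'|nbh] := boolP (b.+1 \in h); last by left; exists b.
by right; split => //; rewrite cnt_recr// bh'; lia.
Qed.

(** * Lazy storage functions *)

Definition increasing_on (h : seq nat) (f : nat -> nat) :=
  forall x y, x \in h -> y \in h -> x < y -> f x < f y.

Definition between_closed (mv : pred nat) :=
  forall a b c, a <= b -> b <= c -> mv a -> mv c -> mv b.

Definition pushed (h : seq nat) (y : nat) (f g : nat -> nat) (k : nat) : bool :=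
  [|| k == y,
      (y < k) && all (fun k' => (y < k' <= k) ==> (g k' < f k')) h |
      (k < y) && all (fun k' => (k <= k' < y) ==> (f k' < g k')) h].

(** In [pushed], [f] is the new storage and [g] the old one; the predicate holds on the run around
    [y] in which [f] pushes every key away from [y]. *)
Lemma pushed_self h y f g : pushed h y f g y.
Proof. by rewrite /pushed eqxx. Qed.

Lemma pushedR h y f g k : y < k -> pushed h y f g k ->
  forall x, x \in h -> y < x -> x <= k -> g x < f x.
Proof.
move=> yk /or3P[/eqP e|/andP[_ /allP H]|/andP[]]; [lia| |lia].
by move=> x xh yx xk; have := H _ xh; rewrite yx xk.
Qed.

Lemma pushedL h y f g k : k < y -> pushed h y f g k ->
  forall x, x \in h -> k <= x -> x < y -> f x < g x.
Proof.
move=> yk /or3P[/eqP e|/andP[]|/andP[_ /allP H]]; [lia|lia|].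
by move=> x xh yx xk; have := H _ xh; rewrite yx xk.
Qed.

Lemma pushedNR h y f g k : y < k -> ~~ pushed h y f g k ->
  exists x, [/\ x \in h, y < x, x <= k & f x <= g x].
Proof.
move=> yk; rewrite /pushed !negb_or yk /= => /and3P[_ /allPn[x xh + _]].
by rewrite negb_imply -leqNgt => /andP[/andP[yx xk] fg]; exists x.
Qed.

Lemma pushedNL h y f g k : k < y -> ~~ pushed h y f g k ->
  exists x, [/\ x \in h, k <= x, x < y & g x <= f x].
Proof.
move=> yk; rewrite /pushed !negb_or yk /= => /and3P[_ _ /allPn[x xh +]].
by rewrite negb_imply -leqNgt => /andP[/andP[yx xk] fg]; exists x.
Qed.

Lemma pushed_between h y f g : between_closed (pushed h y f g).
Proof.
move=> a b c ab bc ma mc; case: (ltngtP b y) => [lt|gt|->]; last exact: pushed_self.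
- apply/or3P/Or33; rewrite lt /=; apply/allP => x xh; apply/implyP => /andP[bx xy].
  by apply: (pushedL _ ma xh); lia.
- apply/or3P/Or32; rewrite gt /=; apply/allP => x xh; apply/implyP => /andP[bx xy].
  by apply: (pushedR _ mc xh); lia.
Qed.

(** To the right of the pushed run there is a key [x] with [f x <= g x], so a pushed key [k]
    satisfies [f k < f x <= g x]; the left side is symmetric. Hence the run may follow [f] while the
    other keys stay at [g]. *)
Lemma pushed_increasing h y f g :
  increasing_on (y :: h) f -> increasing_on h g ->
  increasing_on (y :: h) (fun k => if pushed h y f g k then f k else g k).
Proof.
move=> fi gi x z xh zh xz.
have inh k : k \in y :: h -> ~~ pushed h y f g k -> k \in h.
  by rewrite inE => /predU1P[->|//]; rewrite pushed_self.
have fle a b : a \in y :: h -> b \in y :: h -> a <= b -> f a <= f b.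
  by move=> ah bh; rewrite leq_eqVlt => /predU1P[->//|/(fi _ _ ah bh)/ltnW].
have gle a b : a \in h -> b \in h -> a <= b -> g a <= g b.
  by move=> ah bh; rewrite leq_eqVlt => /predU1P[->//|/(gi _ _ ah bh)/ltnW].
have yyh : y \in y :: h by rewrite inE eqxx.
have hyh k : k \in h -> k \in y :: h by rewrite inE orbC => ->.
case: (boolP (pushed h y f g x)) => px; case: (boolP (pushed h y f g z)) => pz.
- exact: fi.
- have zin := inh _ zh pz; case: (ltngtP z y) pz => [zy|yz|->] pz; last by rewrite pushed_self in pz.
    have [k [kh zk ky gf]] := pushedNL zy pz.
    have := pushedL _ px kh; lia.
  have [k [kh yk kz fg]] := pushedNR yz pz.
  have xk : x < k.
    by rewrite ltnNge; apply/negP => kx; have := pushedR _ px kh; lia.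
  have := fi _ _ xh (hyh _ kh) xk; have := gle _ _ kh zin kz; lia.
- have xin := inh _ xh px; case: (ltngtP x y) px => [xy|yx|->] px; last by rewrite pushed_self in px.
    have [k [kh zk ky gf]] := pushedNL xy px.
    have kz : k < z.
      by rewrite ltnNge; apply/negP => kx; have := pushedL _ pz kh; lia.
    have := fi _ _ (hyh _ kh) zh kz; have := gle _ _ xin kh zk; lia.
  have [k [kh yk kz fg]] := pushedNR yx px.
  by have := pushedR _ pz kh; lia.
- exact: gi (inh _ xh px) (inh _ zh pz) xz.
Qed.

Lemma leq_count2 (P Q P' Q' : pred nat) (s : seq nat) :
  (forall k, k \in s -> P k + Q k <= P' k + Q' k) ->
  count P s + count Q s <= count P' s + count Q' s.
Proof.
elim: s => //= k s IH H.
have := H k; rewrite inE eqxx => /(_ isT).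
suff : count P s + count Q s <= count P' s + count Q' s by lia.
by apply: IH => x xs; apply: H; rewrite inE xs orbT.
Qed.

Section Lazy.
Variable F : seq nat -> nat -> nat.

Fixpoint lazy (h : seq nat) : nat -> nat :=
  if h is y :: h' then
    fun k => if pushed h' y (F h) (lazy h') k then F h k else lazy h' k
  else F [::].

(** The new key itself is left uncounted, which only strengthens lower bounds proved for this
    cost. *)
Fixpoint lazy_cost (h : seq nat) : nat :=
  if h is y :: h' then lazy_cost h' + count (pushed h' y (F h) (lazy h')) h'
  else 0.

Fixpoint cost (h : seq nat) : nat :=
  if h is y :: h' then
    cost h' + count (fun k => (k == y) || (F h k != F h' k)) h
  else 0.

Lemma lazy_increasing h :
  (forall i, increasing_on (drop i h) (F (drop i h))) -> increasing_on h (lazy h).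
Proof.
elim: h => [|y h IH] Fi //=; apply: pushed_increasing; first exact: (Fi 0).
by apply: IH => i; apply: (Fi i.+1).
Qed.

Lemma lazy_range h m k : (forall i, i <= size h -> F (drop i h) k < m) -> lazy h k < m.
Proof.
elim: h => [|y h IH] Fm /=; first exact: (Fm 0).
by case: ifP => _; [exact: (Fm 0)|apply: IH => i ih; apply: (Fm i.+1)].
Qed.

(* Keys on which the lazy storage lags behind have not been paid for yet. *)
Lemma lazy_cost_lag (h : seq nat) : uniq h ->
  lazy_cost h + count (fun k => F h k != lazy h k) h <= cost h.
Proof.
elim: h => [|y h IH] //= /andP[yh /IH{}IH].
rewrite eqxx pushed_self eqxx /=.
set f := F (y :: h); set g := lazy h; set f0 := F h.
rewrite -/f0 -/g in IH.
have : count (pushed h y f g) h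
    + count (fun k => f k != (if pushed h y f g k then f k else g k)) h
    <= count (fun k => f0 k != g k) h + count (fun k => (k == y) || (f k != f0 k)) h.
  apply: leq_count2 => k kh; have ky : k != y by apply: contraNneq yh => <-.
  rewrite (negbTE ky) /=; case: ifP => [pk|_].
    have : f k != g k.
      case: (ltngtP k y) ky pk => // [lt|gt] _ pk.
        by have := pushedL lt pk kh (leqnn k) lt; lia.
      by have := pushedR gt pk kh gt (leqnn k); lia.
    by rewrite eqxx; case: (eqVneq (f0 k) (g k)) => [-> ->|].
  by case: (eqVneq (f0 k) (g k)) => [->|_] //; case: (_ != _).
move: IH; set a := count _ _; set b := count _ _; set c := count _ _.
set d := count _ _; lia.
Qed.
End Lazy.

(** * The game as the adversary sees it *)

Definition good (r n : nat) (h : seq nat) : bool :=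
  [&& uniq h, all (fun k => k < r) h & size h <= n].

(* Histories are listed backwards, the last key first. *)
Record lazy_game (n m r : nat) (Lz : seq nat -> nat -> nat) (LC : seq nat -> nat) : Prop :=
  LazyGame {
    lz_incr : forall h, good r n h -> increasing_on h (Lz h);
    lz_range : forall h k, good r n h -> k \in h -> Lz h k < m;
    lz_step : forall y h, good r n (y :: h) -> exists mv : pred nat,
      [/\ between_closed mv, mv y, forall k, k \in h -> ~~ mv k -> Lz (y :: h) k = Lz h k &
        LC h + count mv h <= LC (y :: h)] }.

Local Open Scope ring_scope.

(* lia and lra slow down drastically on irrelevant hypotheses and on local
   definitions. *)
Ltac natlia :=
  repeat match goal with
  | H : is_true (leq _ _) |- _ => revert H
  | H : is_true (andb _ _) |- _ => revert H
  | H : @eq nat _ _ |- _ => revert H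
  end;
  clear; intros; lia.
Ltac natnia :=
  repeat match goal with
  | H : is_true (leq _ _) |- _ => revert H
  | H : is_true (andb _ _) |- _ => revert H
  | H : @eq nat _ _ |- _ => revert H
  end;
  clear; intros; nia.

Ltac ordlra :=
  repeat match goal with
  | H : is_true (Order.le _ _) |- _ => revert H
  | H : is_true (Order.lt _ _) |- _ => revert H
  end;
  clear; intros;
  repeat match goal with x := _ |- _ => clearbody x end;
  lra.

(** * Intervals of keys, levels and chains *)

Section Chain.
Variable R : realType.
(** All insertions go to [[rlo, rhi]], whose sparsity and score [a0] and [h0] bound. A level has at
    least [thr] keys at birth, and one of size [M] may absorb [M %/ W] keys. From a level to the
    next, sparsity and score may increase by [u] and [v]; [c1] is the rate at which insertions lower
    the sparsity. *)
Variables (B W thr m rlo rhi : nat) (lam tau u v c1 kap a0 h0 : R).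
Hypotheses (lam_ge0 : 0 <= lam) (kapE : kap = 1 + lam * B%:R) (tau_gt0 : 0 < tau).
Hypotheses (W8 : (8 <= W)%N) (W_thr : (W <= thr)%N).
Hypothesis u_ge : 8 * (tau * ln (2 * W)%:R) * kap <= u * W%:R.
Hypothesis v_ge : u + tau * ln 8 <= v.
Hypotheses (c1_ge0 : 0 <= c1) (c1_le : c1 * kap ^+ 2 <= 1).

(* The drop of sparsity that makes up in [score] for the loss of size of a prefix
   or suffix of at least a fraction 1 / (2 W). *)
Definition drop_unit : R := tau * ln (2 * W)%:R.

Lemma kap_ge1 : 1 <= kap.
Proof. by rewrite kapE lerDl mulr_ge0. Qed.

(** [ws_spacing] keeps weights within the factor [kap] of key counts; it survives the insertion of
    the successor of an old key. *)
Record well_spread (h : seq nat) (g : nat -> nat) : Prop := WellSpread {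
  ws_uniq : uniq h;
  ws_incr : increasing_on h g;
  ws_spacing : forall a b, a \in h -> b \in h -> (a <= b)%N -> (b - a <= B * cnt h a b)%N;
  ws_lo : rlo \in h;
  ws_hi : rhi \in h;
  ws_range : forall k, k \in h -> (g k < m)%N }.

(** The sparsity of [(a, b]] is [width / weight]. Both are additive, and bounds on sparsity are
    stated without division. *)
Definition weight (h : seq nat) (a b : nat) : R :=
  (cnt h a b)%:R + lam * (b%:R - a%:R).
Definition width (g : nat -> nat) (a b : nat) : R := (g b)%:R - (g a)%:R.

Lemma weight_split h a b c : (a <= b)%N -> (b <= c)%N ->
  weight h a c = weight h a b + weight h b c.
Proof. by move=> ab bc; rewrite /weight (cnt_split _ ab bc) natrD; ring. Qed.

Lemma width_split g a b c : width g a c = width g a b + width g b c.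
Proof. by rewrite /width; ring. Qed.

Lemma cnt_le_weight h a b : (a <= b)%N -> (cnt h a b)%:R <= weight h a b.
Proof. by move=> ab; rewrite lerDl mulr_ge0// subr_ge0 ler_nat. Qed.

Lemma weight_cons y h a b :
  weight (y :: h) a b = (a < y <= b)%N%:R + weight h a b.
Proof. by rewrite /weight cnt_cons natrD addrA. Qed.

Section Snapshot.
Variables (h : seq nat) (g : nat -> nat).
Hypothesis hg : well_spread h g.
Let uh := ws_uniq hg.

Lemma weight_le a b : a \in h -> b \in h -> (a <= b)%N ->
  weight h a b <= kap * (cnt h a b)%:R.
Proof.
move=> ah bh ab; rewrite /weight kapE mulrDl mul1r lerD2l -mulrA ler_wpM2l//.
by rewrite -natrB// -natrM ler_nat (ws_spacing hg).
Qed.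

Lemma cnt_le_width a b : a \in h -> b \in h -> (a <= b)%N ->
  (cnt h a b)%:R <= width g a b.
Proof.
move=> ah bh ab; have := cnt_le_strict uh (ws_incr hg) ah bh ab.
by rewrite /width -(ler_nat R) natrD; lra.
Qed.

Lemma sparsity_ge a b d : a \in h -> b \in h -> (a < b)%N ->
  width g a b <= d * weight h a b -> 1 <= d * kap.
Proof.
move=> ah bh ab le.
have c0 : (0 : R) < (cnt h a b)%:R by rewrite ltr0n cnt_gt0.
have cw := cnt_le_width ah bh (ltnW ab); have wl := weight_le ah bh (ltnW ab).
have lw := cnt_le_weight h (ltnW ab).
have w0 : 0 < weight h a b by apply: lt_le_trans lw.
have d0 : 0 <= d by rewrite -(pmulr_lge0 _ w0); lra.
have : d * weight h a b <= d * (kap * (cnt h a b)%:R) by apply: ler_wpM2l.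
by move=> le2; rewrite -(ler_pM2r c0); lra.
Qed.

(** Bisect by rank: as width and weight are additive, one of the halves is at most as sparse as the
    whole. *)
Lemma dense_piece a b d s : a \in h -> b \in h -> (a < b)%N -> (0 < s)%N ->
  (s <= cnt h a b)%N -> width g a b <= d * weight h a b ->
  exists a' b', [/\ a' \in h, b' \in h, (a <= a' < b')%N && (b' <= b)%N,
    (s <= cnt h a' b' <= 2 * s)%N & width g a' b' <= d * weight h a' b'].
Proof.
move=> + + + s0; have [N] := ubnP (cnt h a b); elim: N a b => // N IH a b lN ah bh ab sc dn.
have [c2|c2] := leqP (cnt h a b) (2 * s).
  by exists a, b; rewrite ah bh ab sc c2 leqnn leqnn.
have [|z [zh az zb cz]] := @rank_ex h a b ((cnt h a b)./2) uh ah (ltnW ab); first natlia.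
have cs := cnt_split h az zb.
have az' : (a < z)%N by apply: (@cnt_lt h); natlia.
have zb' : (z < b)%N by apply: (@cnt_lt h); natlia.
move: dn; rewrite (width_split g a z b) (weight_split _ az zb) => dn.
have [d1|d1] := lerP (width g a z) (d * weight h a z).
  have [||a' [b' [? ? ? ? ?]]] := IH a z _ ah zh az' _ d1; [natlia|natlia|].
  by exists a', b'; split => //; natlia.
have [|||a' [b' [? ? ? ? ?]]] := IH z b _ zh bh zb'; [natlia|natlia|by rewrite mulrDr in dn; lra|].
by exists a', b'; split => //; natlia.
Qed.

End Snapshot.

(* [lo, hi] grows inside the interval in which the level was born; slots and
   sparsity are the size and the sparsity of the latter at birth, age counts the
   insertions since birth and used the keys by which [lo, hi] has been extended. *)
Record level := Level {
  lo : nat; hi : nat; age : nat; used : nat; slots : nat; sparsity : R }.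

Definition slack (x : level) : nat := slots x %/ W.
Definition score (a : R) (M : nat) : R := a - tau * ln M%:R.

(* Chains are listed from the innermost level; the root [rlo, rhi] is the parent
   of the last one. *)
Definition parent_lo (c : seq level) := if c is x :: _ then lo x else rlo.
Definition parent_hi (c : seq level) := if c is x :: _ then hi x else rhi.

(** What the innermost level of a chain, or the root, demands of a next level. The last term of
    [bound_score] credits the insertions made before the birth of the next level; as both ages grow
    together, it does not change. *)
Definition bound_sparsity (c : seq level) : R := if c is p :: _ then sparsity p + u else a0.
Definition bound_slots (c : seq level) : nat := if c is p :: _ then slots p else 2 * m.
Definition bound_score (c : seq level) (n : nat) : R :=
  if c is p :: _ then score (sparsity p) (slots p) + v - c1 * ((age p)%:R - n%:R) / (slots p)%:R
  else h0.

Definition linked (c : seq level) (n M : nat) (a : R) : Prop :=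
  [/\ (if c is p :: _ then n <= age p else true)%N, (2 * M <= bound_slots c)%N,
      a <= bound_sparsity c & score a M <= bound_score c n].

(* Whatever the insertions since birth, all the intervals to which [lo, hi] may
   still be extended had at birth a sparsity of at most sparsity x + u. *)
Definition robust (h : seq nat) (g : nat -> nat) (x : level) : Prop :=
  forall a b, a \in h -> b \in h -> (a <= lo x)%N -> (hi x <= b)%N ->
  (cnt h a (lo x) + cnt h (hi x) b + used x <= slack x)%N ->
  width g a b <= (sparsity x + u) * (weight h a b - (age x)%:R) /\
  weight h a b - (age x)%:R <= kap * (slots x)%:R.

(** More keys lie between a level and either end of its parent than the level may still absorb. So
    its extensions stay strictly inside, and when an end of the parent moves, enough keys have moved
    to pay for the level. *)
Record level_ok h g (plo phi : nat) (x : level) : Prop := LevelOk {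
  lo_in : lo x \in h;
  hi_in : hi x \in h;
  lo_hi : (lo x < hi x)%N;
  used_le : (used x <= slack x)%N;
  thr_le : (thr <= slots x)%N;
  sparsity_ge0 : 0 <= sparsity x;
  depth_lo : (slack x < used x + cnt h plo (lo x))%N;
  depth_hi : (slack x < used x + cnt h (hi x) phi)%N;
  slots_le : (slots x <= 2 * cnt h (lo x) (hi x))%N;
  is_robust : robust h g x }.

Fixpoint chain_ok h g (c : seq level) : Prop :=
  if c is x :: c' then
    [/\ level_ok h g (parent_lo c') (parent_hi c') x,
        linked c' (age x) (slots x) (sparsity x) & chain_ok h g c']
  else True.

(* 1 / kap is a lower bound for all sparsities. *)
Definition exhausted (c : seq level) : Prop := kap^-1 - tau * ln thr%:R <= bound_score c 0.

(** * Growing the chain inwards *)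

Lemma parent_in h g c : well_spread h g -> chain_ok h g c ->
  parent_lo c \in h /\ parent_hi c \in h.
Proof.
by case: c => [|x c] hg /=; [split; [apply: ws_lo hg|apply: ws_hi hg]|case=> -[]].
Qed.

Lemma parent_nested h g x c : level_ok h g (parent_lo c) (parent_hi c) x ->
  (parent_lo c < lo x)%N /\ (hi x < parent_hi c)%N.
Proof. by case=> *; split; apply: (@cnt_lt h); natlia. Qed.

(** Induction on the number of keys of [(a, b]]. Below [thr] keys the score bound says that the
    chain is exhausted. If a piece with about [1 / W] of the keys is less sparse by [drop_unit], it
    replaces the interval; otherwise the middle becomes a level, and the search continues in a piece
    of it. *)
Lemma extend_chain h g c a b d : well_spread h g -> chain_ok h g c ->
  a \in h -> b \in h -> (parent_lo c <= a < b)%N -> (b <= parent_hi c)%N ->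
  width g a b <= d * weight h a b -> linked c 0 (cnt h a b) d ->
  exists c', chain_ok h g (c' ++ c) /\ exhausted (c' ++ c) /\
    all (fun x => (age x == 0) && (used x == 0))%N c'.
Proof.
move=> hg; have uh := ws_uniq hg.
have [N] := ubnP (cnt h a b); elim: N a b c d => // N IH a b c d lN okc ah bh.
move=> /andP[pa ab] bp dn lk.
have c0 : (0 < cnt h a b)%N by apply: cnt_gt0.
have W0 : (0 < W)%N by natlia.
have lnW : 0 <= ln (2 * W)%:R :> R by rewrite ln_ge0// ler1n; natlia.
have k1 := kap_ge1.
case: (ltnP (cnt h a b) thr) => [lt|ge].
  exists [::]; split => //; split => //; rewrite /exhausted /=.
  case: lk => _ _ _; apply: le_trans; rewrite /score lerB//.
    have := sparsity_ge hg ah bh ab dn; rewrite -ler_pdivrMr ?div1r//; lra.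
  by rewrite ler_wpM2l ?(ltW tau_gt0)// ler_ln ?posrE ?ltr0n ?ler_nat; natlia.
set M := cnt h a b in lN c0 ge lk *.
(* Both the size of the pieces to be tested and the slack of the level to be born. *)
set w := (M %/ W)%N.
have wM : (w * W <= M)%N by rewrite leq_trunc_div.
have w0 : (0 < w)%N by rewrite divn_gt0; natlia.
have Mw : (M < 2 * W * w)%N.
  by have := ltn_ceil M W0; rewrite -/w; natnia.
have desc a' b' : a' \in h -> b' \in h -> (a <= a' < b')%N -> (b' <= b)%N ->
    (w <= cnt h a' b' <= 2 * w)%N ->
    width g a' b' <= (d - drop_unit) * weight h a' b' ->
    exists c', chain_ok h g (c' ++ c) /\ exhausted (c' ++ c) /\
      all (fun x => (age x == 0) && (used x == 0))%N c'.
  move=> a'h b'h /andP[aa' ab'] bb' /andP[wc cw] dn'.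
  apply: (IH a' b' c _ _ okc a'h b'h _ _ dn'); [natnia|natlia|natlia|].
  case: lk => l1 l2 l3 l4; split => //.
  - by apply: leq_trans l2; natnia.
  - by apply: le_trans l3; rewrite gerBl mulr_ge0 ?(ltW tau_gt0).
  - apply: le_trans l4; rewrite /score /drop_unit.
    rewrite -addrA lerD2l -opprD lerN2 -mulrDr ler_wpM2l ?(ltW tau_gt0)//.
    rewrite -lnM ?posrE ?ltr0n; [|natlia..].
    by rewrite ler_ln ?posrE -?natrM ?ltr0n ?ler_nat; natnia.
case: (pselect (exists a' b', [/\ a' \in h, b' \in h, (a <= a' < b')%N && (b' <= b)%N,
    (w <= cnt h a' b' <= 2 * w)%N & width g a' b' <= (d - drop_unit) * weight h a' b'])).
  by move=> [a' [b' [a'h b'h /andP[e1 e2] e3 e4]]]; apply: (desc a' b').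
move=> bal.
(* With [2 * w] keys cut off at each end, every extension by at most [w] keys leaves a prefix and a
   suffix of [w] to [2 * w] keys, to which [bal] applies. *)
have [|l [lh al lb cl]] := @rank_ex h a b (2 * w) uh ah (ltnW ab); first by rewrite -/M; natnia.
have [|r [rh ar rb cr]] := @rank_ex h a b (M - 2 * w) uh ah (ltnW ab); first by rewrite -/M; natnia.
have cal := cnt_split h al lb; have car := cnt_split h ar rb.
rewrite -/M in cal car.
have lr : (l < r)%N.
  rewrite ltnNge; apply/negP => rl.
  have := cnt_split h ar rl; natnia.
have clr := cnt_split h al (ltnW lr).
pose x := Level l r 0 0 M d.
have okx : level_ok h g (parent_lo c) (parent_hi c) x.
  split => //=.
  - have := sparsity_ge hg ah bh ab dn; have : 0 < kap by lra.
    by move=> k0 le; rewrite -(pmulr_lge0 _ k0); lra.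
  - rewrite /slack /= -/w; have := cnt_split h pa al; natlia.
  - rewrite /slack /= -/w; have := cnt_split h rb bp; natlia.
  - natnia.
  move=> a' b' a'h b'h /= a'l rb'; rewrite /slack /= addn0 -/w => wc.
  have aa' : (a <= a')%N.
    rewrite leqNgt; apply/negP => lt.
    by have := cnt_split h (ltnW lt) al; natlia.
  have bb' : (b' <= b)%N.
    rewrite leqNgt; apply/negP => lt.
    by have := cnt_split h rb (ltnW lt); natlia.
  have ca' := cnt_split h aa' a'l; have cb' := cnt_split h rb' bb'.
  have a'b' : (a' < b')%N by natlia.
  have ltaa' : (a < a')%N by apply: (@cnt_lt h); natlia.
  have ltbb' : (b' < b)%N by apply: (@cnt_lt h); natlia.
  have pre : (d - drop_unit) * weight h a a' < width g a a'.
    rewrite ltNge; apply/negP => le; apply: bal; exists a, a'; split => //; natlia.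
  have suf : (d - drop_unit) * weight h b' b < width g b' b.
    rewrite ltNge; apply/negP => le; apply: bal; exists b', b; split => //; natlia.
  have Ws : weight h a b = weight h a a' + weight h a' b' + weight h b' b.
    by rewrite (weight_split _ aa' (leq_trans (ltnW a'b') bb')) (weight_split _ (ltnW a'b') bb') addrA.
  have Wpre := weight_le hg ah a'h (ltnW ltaa').
  have Wsuf := weight_le hg b'h bh (ltnW ltbb').
  have WQ := weight_le hg a'h b'h (ltnW a'b').
  have cQ := cnt_le_weight h (ltnW a'b').
  have cab' := cnt_split h aa' (ltnW a'b').
  have cab := cnt_split h (leq_trans aa' (ltnW a'b')) bb'.
  have cQM : (M <= 2 * cnt h a' b')%N by move: cab; rewrite -/M; natnia.
  split; last first.
    rewrite subr0; apply: (le_trans WQ); rewrite ler_wpM2l ?ler_nat; [|lra|].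
      by [].
    by move: cab; rewrite -/M; natlia.
  (* The prefix and the suffix have sparsity above [d - drop_unit] and at most [4 * w] keys
     together, so removing them raises the sparsity by at most [u]. *)
  rewrite subr0; move: dn; rewrite (width_split g a a' b) (width_split g a' b' b) Ws => dn.
  have cw4 : (cnt h a a' + cnt h b' b <= 4 * w)%N by natlia.
  have s0 : 0 <= drop_unit by rewrite mulr_ge0 ?(ltW tau_gt0).
  have t1 : drop_unit * (weight h a a' + weight h b' b) <= drop_unit * kap * (4 * w)%:R.
    rewrite -mulrA ler_wpM2l//; apply: (@le_trans _ _ (kap * (cnt h a a' + cnt h b' b)%:R)).
      by rewrite natrD; lra.
    by rewrite ler_wpM2l ?ler_nat//; lra.
  have W0' : 0 < W%:R :> R by rewrite ltr0n.
  have u0 : 0 <= u.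
    by rewrite -(pmulr_lge0 _ W0'); apply: le_trans u_ge; apply: mulr_ge0; [apply: mulr_ge0|apply: le_trans k1].
  have t2 : drop_unit * kap * (4 * w)%:R <= u * (cnt h a' b')%:R.
    have e1 : 8 * drop_unit * kap * w%:R <= u * W%:R * w%:R by rewrite ler_wpM2r.
    have e2 : u * (w * W)%:R <= u * (2 * cnt h a' b')%:R by rewrite ler_wpM2l// ler_nat; natlia.
    by move: e2; rewrite !natrM; lra.
  have t3 : u * (cnt h a' b')%:R <= u * weight h a' b' by apply: ler_wpM2l.
  by lra.
(* A piece of [q] to [2 * q] keys has at most half the size of the level and more than an eighth of
   it, whence the [ln 8] in [v_ge]. *)
set q := (M %/ 4)%N.
have [q1 q2] : (4 * q <= M)%N /\ (M < 8 * q)%N.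
  by rewrite /q; move: W8 W_thr ge; clear; lia.
have Wlr := is_robust okx lh rh (leqnn l) (leqnn r).
rewrite /= !cntxx /= in Wlr.
have [//|Wlr1 _] := Wlr; rewrite subr0 in Wlr1.
have [||a' [b' [a'h b'h /andP[/andP[la' a'b'] b'r] /andP[qc cq] dn']]] :=
    dense_piece hg lh rh lr _ _ Wlr1 (s := q); [natlia|natnia|].
have okxc : chain_ok h g (x :: c) by [].
have [||||c' [okc' [exc' fresh]]] := IH a' b' (x :: c) (d + u) _ okxc a'h b'h _ _ dn' _.
- natlia.
- by rewrite /= la' a'b'.
- by [].
- split => //=; first natlia.
  rewrite /score !subrr mulr0 mul0r subr0.
  have : ln M%:R <= ln 8 + ln (cnt h a' b')%:R :> R.
    by rewrite -lnM ?posrE ?ltr0n//; [rewrite ler_ln ?posrE -?natrM ?ltr0n ?ler_nat|]; natlia.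
  by move=> /(ler_wpM2l (ltW tau_gt0)); rewrite mulrDr; move: v_ge; move: (tau * ln M%:R) (tau * ln 8) (tau * ln _) => A1 A2 A3 e1 e2; lra.
by exists (rcons c' x); rewrite cat_rcons; split => //; split => //; rewrite all_rcons /=.
Qed.

(** * The potential of a chain and its repair after an insertion *)

Variables (alpha ce : R).
(* What a level of size M has earned after n insertions.  It is quadratic because
   the level earns less and less as it fills up, and at most M / W in total. *)
Definition earn (n M : nat) : R := ce * (n%:R - n%:R ^+ 2 / (2 * alpha * M%:R)).
Hypothesis earn_le : forall n M, (thr <= M)%N -> earn n M <= (M %/ W)%:R.

(** Earnings not yet spent: a key absorbed by an extension costs one unit. *)
Definition pot (x : level) : R := earn (age x) (slots x) - (used x)%:R.
Definition gain (x : level) : R := earn (age x).+1 (slots x) - earn (age x) (slots x).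
Definition total_pot (c : seq level) : R := \sum_(x <- c) pot x.
Definition total_gain (c : seq level) : R := \sum_(x <- c) gain x.

Definition older (x : level) : level :=
  Level (lo x) (hi x) (age x).+1 (used x) (slots x) (sparsity x).

Lemma linked_older c n M a : linked c n M a -> linked (map older c) n.+1 M a.
Proof.
case: c => [|p c] //= [e1 e2 e3 e4]; split => //=; apply: le_trans e4 _.
by rewrite -!natr1 [_ + 1 - _]addrAC opprD addrA addrNK.
Qed.

Lemma total_pot_older c : total_pot (map older c) = total_pot c + total_gain c.
Proof.
rewrite /total_pot /total_gain big_map -big_split /=; apply: eq_bigr => x _.
by rewrite /pot /gain /=; ring.
Qed.

Lemma total_pot_cons x c : total_pot (x :: c) = pot x + total_pot c.
Proof. exact: big_cons. Qed.

Lemma total_gain_cons x c : total_gain (x :: c) = gain x + total_gain c.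
Proof. exact: big_cons. Qed.

Section Insertion.
Variables (h : seq nat) (y : nat) (g g' : nat -> nat) (mv : pred nat).
Hypothesis hg : well_spread h g.
Hypotheses (mv_conv : between_closed mv) (mv_y : mv y).
Hypothesis mv_fix : forall k, k \in h -> ~~ mv k -> g' k = g k.
Let uh := ws_uniq hg.

Lemma unmoved_leftwards a b : (a <= b)%N -> (b <= y)%N -> ~~ mv b -> ~~ mv a.
Proof. by move=> ab lby; apply: contra => ma; apply: mv_conv ab lby ma mv_y. Qed.

Lemma unmoved_rightwards a b : (y <= a)%N -> (a <= b)%N -> ~~ mv a -> ~~ mv b.
Proof. by move=> ya ab; apply: contra => ma; apply: mv_conv ya ab mv_y ma. Qed.

(** The ends of any further extension lie beyond the unmoved [l] and [r], hence are unmoved, and the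
    width is unchanged; the new key adds one to both weight and age. So [robust] survives. *)
Lemma level_extend p q x l r used' : level_ok h g p q x ->
  (p < lo x)%N -> (hi x < q)%N -> (lo x < y < hi x)%N ->
  l \in h -> r \in h -> (p <= l <= lo x)%N -> (hi x <= r <= q)%N ->
  ~~ mv l -> ~~ mv r ->
  used' = (used x + cnt h l (lo x) + cnt h (hi x) r)%N -> (used' <= slack x)%N ->
  level_ok (y :: h) g' p q (Level l r (age x).+1 used' (slots x) (sparsity x)).
Proof.
move=> [lh hh lohi usl thl avl dl dh mbl rb] pl hq /andP[ly yh'] lin rin /andP[pl' llo] /andP[hir rq] ml mr ue ul.
have s1 := cnt_split h pl' llo; have s2 := cnt_split h hir rq.
have s3 := cnt_split h llo (ltnW lohi).
have s4 := cnt_split h (leq_trans llo (ltnW lohi)) hir.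
split => //=.
- by rewrite inE lin orbT.
- by rewrite inE rin orbT.
- by natlia.
- by rewrite cnt_cons /slack /= -/(slack x); natlia.
- by rewrite cnt_cons /slack /= -/(slack x); natlia.
- by rewrite cnt_cons; natlia.
move=> a b; rewrite !inE => /predU1P[->|ah] /predU1P[->|bh] /= al rb';
  try by move=> _; natlia.
have s5 := cnt_split h al llo; have s6 := cnt_split h hir rb'.
have ly' : (l <= y)%N by natlia.
have yr : (y <= r)%N by natlia.
rewrite !cnt_cons /slack /= -/(slack x).
have -> : (a < y <= l)%N = false by natlia.
have -> : (r < y <= b)%N = false by natlia.
rewrite !add0n => cle.
have [|||b1 b2] := rb a b ah bh; try by natlia.
rewrite /width !mv_fix ?(unmoved_leftwards al ly' ml) ?(unmoved_rightwards yr rb' mr)// -/(width _ _ _).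
have -> : weight (y :: h) a b - (age x).+1%:R = weight h a b - (age x)%:R.
  have -> : (age x).+1%:R = 1 + (age x)%:R :> R by rewrite -natr1 addrC.
  rewrite weight_cons; have -> : (a < y <= b)%N by natlia.
  by rewrite opprD addrACA subrr add0r.
by split.
Qed.

(** The moved keys form an interval around [y], so if the ends of the innermost level stay, those of
    all outer levels stay too. *)
Lemma chain_older c : chain_ok h g c -> (parent_lo c < y < parent_hi c)%N ->
  ~~ mv (parent_lo c) -> ~~ mv (parent_hi c) -> chain_ok (y :: h) g' (map older c).
Proof.
elim: c => [|x c IH] //= [okx lk okc] /andP[ly yhx] ml mh.
have [pl ph] := parent_nested okx.
have ml' : ~~ mv (parent_lo c) by apply: unmoved_leftwards ml; apply: ltnW.
have mh' : ~~ mv (parent_hi c) by apply: unmoved_rightwards mh; apply: ltnW.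
have pE : parent_lo (map older c) = parent_lo c /\ parent_hi (map older c) = parent_hi c.
  by case: (c).
split; [|exact: linked_older|by apply: IH => //; natlia].
rewrite pE.1 pE.2; apply: (level_extend okx) => //.
- by rewrite ly.
- exact: lo_in okx.
- exact: hi_in okx.
- by rewrite leqnn andbT ltnW.
- by rewrite leqnn ltnW.
- by rewrite !cntxx !addn0.
- exact: used_le okx.
Qed.

Definition moved_out (a b : nat) : nat := count (fun k => mv k && ~~ (a < k < b)%N) h.

Lemma moved_out_split (p q l r : nat) (P : pred nat) : (p <= l)%N -> (r <= q)%N ->
  (forall k, k \in h -> P k -> mv k && (p < k < q)%N && ~~ (l < k < r)%N) ->
  (moved_out p q + count P h <= moved_out l r)%N.
Proof.
move=> pl rq; rewrite /moved_out; elim: (h) => //= k s IH H.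
have /IH{}IH : forall j, j \in s -> P j -> mv j && (p < j < q)%N && ~~ (l < j < r)%N.
  by move=> j js; apply: H; rewrite inE js orbT.
have := H k; rewrite inE eqxx => /(_ isT); move: IH.
by case: (P k) (mv k) => -[] /= IH H1; try have := H1 isT; move: pl rq; clear -IH; lia.
Qed.

(* A level that dies is paid by the moved keys between it and its parent; hence a
   moved key is not charged twice. *)
Lemma repair_chain c : chain_ok h g c -> (parent_lo c < y < parent_hi c)%N ->
  exists c', chain_ok (y :: h) g' c' /\
    total_pot c + total_gain c <= total_pot c' + (moved_out (parent_lo c) (parent_hi c))%:R.
Proof.
elim: c => [|x c IH].
  by move=> _ _; exists [::]; split => //; rewrite /total_pot /total_gain !big_nil !add0r.
move=> [okx lk okc] /= /andP[ly yhx].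
have [pl ph] := parent_nested okx.
have [pin qin] := parent_in hg okc.
have [lin hin] := (lo_in okx, hi_in okx).
have usl := used_le okx.
(* So [slack x - used x] moved keys are enough to pay for the death of [x]. *)
have earnx : pot x + gain x <= (slack x - used x)%:R.
  by rewrite natrB// /pot /gain; have := @earn_le (age x).+1 _ (thr_le okx); rewrite -/(slack x); lra.
have sumE : total_pot (x :: c) + total_gain (x :: c)
    = pot x + gain x + (total_pot c + total_gain c).
  by rewrite total_pot_cons total_gain_cons; ring.
have pyq : (parent_lo c < y < parent_hi c)%N by natlia.
(* If an end of the parent moves, so do all keys between it and [x]; they pay for the death of [x],
   and the outer levels are repaired by induction. *)
case: (boolP (mv (parent_lo c) || mv (parent_hi c))) => [touched|].
  have [c' [okc' potc']] := IH okc pyq; exists c'; split => //.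
  suff : (moved_out (parent_lo c) (parent_hi c) + (slack x - used x)
      <= moved_out (lo x) (hi x))%N.
    by rewrite -(ler_nat R) natrD sumE; lra.
  case/orP: touched => mt.
    apply: (@leq_trans (moved_out (parent_lo c) (parent_hi c) + cnt h (parent_lo c) (lo x))).
      by rewrite leq_add2l; have := depth_lo okx; natlia.
    apply: moved_out_split; [exact: ltnW|exact: ltnW|].
    move=> k kh /andP[pk kl]; rewrite (mv_conv (ltnW pk) (_ : (k <= y)%N) mt mv_y); natlia.
  apply: (@leq_trans (moved_out (parent_lo c) (parent_hi c) + cnt h (hi x) (parent_hi c))).
    by rewrite leq_add2l; have := depth_hi okx; natlia.
  rewrite -cnt_shift ?(ltnW ph)//.
  apply: moved_out_split; [exact: ltnW|exact: ltnW|].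
  move=> k kh /andP[pk kl]; rewrite (mv_conv (_ : (y <= k)%N) (ltnW kl) mv_y mt); natlia.
rewrite negb_or => /andP[mlo mhi].
(* Otherwise the outer levels are intact. Extend [x] to the next unmoved keys: the absorbed keys
   have moved and pay one unit each; if they exceed the remaining slack, they pay for the death of
   [x]. *)
have [l [lh pl' llo ml mvl]] := unmoved_left pin (ltnW pl) mlo.
have [r [rh rhi' rq mr mvr]] := unmoved_right qin (ltnW ph) mhi.
have okc' := chain_older okc pyq mlo mhi.
have out : (cnt h l (lo x) + cnt h (hi x) r <= moved_out (lo x) (hi x))%N.
  rewrite -[cnt _ _ r]cnt_shift//.
  apply: leq_trans (_ : moved_out l (hi x) + cnt h l (lo x) <= _)%N; last first.
    apply: moved_out_split => // k kh /andP[lk' kl]; rewrite mvl ?lk'//=; natlia.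
  rewrite addnC leq_add2r; apply: leq_trans (_ : moved_out l r + _ <= _)%N; first exact: leq_addl.
  apply: moved_out_split => // k kh /andP[lk' kl]; rewrite mvr ?lk'//=; natlia.
have pE : parent_lo (map older c) = parent_lo c /\ parent_hi (map older c) = parent_hi c.
  by case: (c).
have [ok|dead] := leqP (used x + cnt h l (lo x) + cnt h (hi x) r) (slack x).
  pose x' := Level l r (age x).+1 (used x + cnt h l (lo x) + cnt h (hi x) r) (slots x) (sparsity x).
  exists (x' :: map older c); split.
    split; [|exact: linked_older|by []].
    rewrite pE.1 pE.2; apply: (level_extend okx) => //.
    - by rewrite ly.
    - by rewrite pl'.
    - by rewrite rhi'.
  rewrite sumE total_pot_cons total_pot_older /pot /gain /=.
  by move: out; rewrite -(ler_nat R) !natrD; lra.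
exists (map older c); split => //.
rewrite sumE total_pot_older.
have : (slack x - used x <= moved_out (lo x) (hi x))%N by natlia.
by rewrite -(ler_nat R); lra.
Qed.

End Insertion.

(** * Completing the chain, and the sparsity budget *)

Variables (M0 K : nat) (amax bud : R).
Hypotheses (m_gt0 : (0 < m)%N) (B_gt0 : (0 < B)%N) (M0_gt0 : (0 < M0)%N) (lt_mK : (m < 2 ^ K)%N).
Hypothesis a0_root : m%:R <= a0 * (M0%:R + lam * (rhi%:R - rlo%:R)).
Hypothesis h0_root : score a0 M0 <= h0.
Hypotheses (a0_ge0 : 0 <= a0) (amax_ge : a0 + K%:R * u <= amax) (amax_free : amax * (1 + lam) < 1).
(** From the root to the end of an exhausted chain the score rises by at least [bud], while each
    level adds at most [v]; this forces chains to be long. *)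
Hypothesis bud_le : bud + h0 <= kap^-1 - tau * ln thr%:R.
Hypotheses (alpha_gt0 : 0 < alpha) (alphaE : alpha * c1 = 8 * v) (ce_ge0 : 0 <= ce).
Hypothesis alpha_thr : 2 <= alpha * thr%:R.

Lemma u_ge0 : 0 <= u.
Proof.
have W0' : 0 < W%:R :> R by rewrite ltr0n; natlia.
rewrite -(pmulr_lge0 _ W0'); apply: le_trans u_ge; apply: mulr_ge0; last exact: le_trans kap_ge1.
by rewrite !mulr_ge0 ?(ltW tau_gt0)// ln_ge0// ler1n; natlia.
Qed.

Lemma v_gt0 : 0 < v.
Proof.
by apply: lt_le_trans v_ge; rewrite ltr_wpDl ?u_ge0// mulr_gt0// ln_gt0// ltr1n.
Qed.

Lemma root_dense h g : well_spread h g -> (M0 <= cnt h rlo rhi)%N ->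
  [/\ (rlo < rhi)%N, width g rlo rhi <= a0 * weight h rlo rhi & linked [::] 0 (cnt h rlo rhi) a0].
Proof.
move=> hg M0c; have c0 : (0 < cnt h rlo rhi)%N by natlia.
have lh := cnt_lt c0.
have wm : (width g rlo rhi <= m%:R).
  have := ws_range hg (ws_hi hg); rewrite /width -(ltr_nat R) => lt.
  by rewrite lerBlDr (le_trans (ltW lt))// lerDl.
split => //.
  apply: (le_trans wm); apply: (le_trans a0_root); rewrite ler_wpM2l// /weight lerD2r.
  by rewrite ler_nat.
split => //=.
  rewrite leq_mul2l /=; have := cnt_le_width hg (ws_lo hg) (ws_hi hg) (ltnW lh).
  by move=> /le_trans/(_ wm); rewrite ler_nat.
apply: le_trans h0_root; rewrite /score lerD2l lerN2 ler_wpM2l ?(ltW tau_gt0)//.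
by rewrite ler_ln ?posrE ?ltr0n ?ler_nat.
Qed.

(** Resume at the innermost level, or at the root. The insertions since its birth have brought the
    sparsity of the level down to at most [sparsity x + u] minus [c1 * age x / slots x]; this is the
    credit in [bound_score]. *)
Lemma complete_chain h g c : well_spread h g -> (M0 <= cnt h rlo rhi)%N -> chain_ok h g c ->
  exists c', chain_ok h g (c' ++ c) /\ exhausted (c' ++ c) /\
    all (fun x => (age x == 0) && (used x == 0))%N c'.
Proof.
move=> hg M0c; case: c => [|x c] okc.
  have [lh dn lk] := root_dense hg M0c.
  by apply: (extend_chain hg okc (ws_lo hg) (ws_hi hg) _ _ dn lk) => //=; rewrite ?leqnn ?lh.
have [okx lk okc'] := okc.
have [[[lh hh] lohi] thrle] := (lo_in okx, hi_in okx, lo_hi okx, thr_le okx).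
have k0 : 0 < kap := lt_le_trans ltr01 kap_ge1.
have mb0 : 0 < (slots x)%:R :> R by rewrite ltr0n; natlia.
have [||| dn wle] := is_robust okx lh hh; rewrite ?cntxx ?(used_le okx)//.
set L := weight h (lo x) (hi x) in dn wle.
pose d := sparsity x + u - c1 * (age x)%:R / (slots x)%:R.
have L0 : 0 < L.
  apply: lt_le_trans (cnt_le_weight h (ltnW lohi)).
  by rewrite ltr0n cnt_gt0.
have age0 : 0 <= (age x)%:R :> R by [].
have wd0 : 0 < width g (lo x) (hi x).
  apply: lt_le_trans (cnt_le_width hg lh hh (ltnW lohi)).
  by rewrite ltr0n cnt_gt0.
have avu : 0 <= sparsity x + u by rewrite addr_ge0 ?u_ge0 ?(sparsity_ge0 okx).
have Lage0 : 0 <= L - (age x)%:R.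
  rewrite leNgt; apply/negP => lt.
  by have := mulr_ge0_le0 avu (ltW lt); lra.
(* By [robust] the width is at most [(sparsity x + u) * (L - age x)], and
   [c1 * L <= (sparsity x + u) * slots x] turns the subtracted age into a drop of sparsity. *)
have dn' : width g (lo x) (hi x) <= d * L.
  have e1 : (sparsity x + u) * (L - (age x)%:R) <= (sparsity x + u) * (kap * (slots x)%:R) by apply: ler_wpM2l.
  have e2 : L <= kap * width g (lo x) (hi x).
    apply: le_trans (weight_le hg lh hh (ltnW lohi)) _.
    by rewrite ler_pM2l// (cnt_le_width hg lh hh (ltnW lohi)).
  have e3 : c1 * L <= c1 * (kap * ((sparsity x + u) * (kap * (slots x)%:R))).
    by rewrite ler_wpM2l// (le_trans e2)// ler_pM2l//; lra.
  have e4 : c1 * (kap * ((sparsity x + u) * (kap * (slots x)%:R))) <= (sparsity x + u) * (slots x)%:R.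
    rewrite [leLHS](_ : _ = c1 * kap ^+ 2 * ((sparsity x + u) * (slots x)%:R)); last by ring.
    by rewrite ler_piMl// mulr_ge0.
  have e5 : c1 * (age x)%:R / (slots x)%:R * L <= (sparsity x + u) * (age x)%:R.
    rewrite [leLHS](_ : _ = c1 * L * (age x)%:R / (slots x)%:R); last by ring.
    rewrite ler_pdivrMr// [leRHS](_ : _ = (sparsity x + u) * (slots x)%:R * (age x)%:R); last by ring.
    by rewrite ler_wpM2r//; lra.
  by rewrite /d mulrBl; move: dn; rewrite mulrBr; lra.
set q := (slots x %/ 4)%N.
have [q1 q2] : (4 * q <= slots x)%N /\ (slots x < 8 * q)%N.
  by rewrite /q; move: W8 W_thr thrle; clear; lia.
have mbl := slots_le okx.
have [||a' [b' [a'h b'h /andP[la' b'r] /andP[qc cq] dn'']]] :=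
    dense_piece hg lh hh lohi _ _ dn' (s := q); [natlia|natlia|].
apply: (extend_chain hg okc a'h b'h _ _ dn'').
- by rewrite /= la'.
- by rewrite /= b'r.
split => //=; first natlia.
  by rewrite /d gerBl mulr_ge0 ?invr_ge0 ?mulr_ge0 ?(ltW mb0).
rewrite /score subr0 /d.
have : ln (slots x)%:R <= ln 8 + ln (cnt h a' b')%:R :> R.
  by rewrite -lnM ?posrE ?ltr0n//; [rewrite ler_ln ?posrE -?natrM ?ltr0n ?ler_nat|]; natlia.
move=> /(ler_wpM2l (ltW tau_gt0)); rewrite mulrDr; move: v_ge.
move: (tau * ln (slots x)%:R) (tau * ln 8) (tau * ln _) (c1 * _ / _) => A1 A2 A3 A4 e1 e2; lra.
Qed.


(** At least halving at each level, the sizes allow only logarithmically many levels. *)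
Lemma chain_size h g c : chain_ok h g c -> (size c <= K)%N.
Proof.
move=> okc; suff : (2 ^ size c * (if c is x :: _ then slots x else 1) <= 2 * m)%N /\
    (if c is x :: _ then 0 < slots x else true)%N.
  move=> [le mb0]; rewrite -ltnS -(@ltn_exp2l 2)//.
  apply: leq_ltn_trans (_ : 2 * m < _)%N; last by rewrite expnS ltn_pmul2l.
  apply: leq_trans le; case: (c) mb0 => [|x c'] mb0; first by rewrite muln1.
  by rewrite leq_pmulr.
elim: c okc => [|x c IH] /=; first by rewrite expn0; natlia.
move=> [okx [_ le _ _] /IH[IH1 IH2]]; split; last by have := thr_le okx; natlia.
move: le IH1; case: (c) => [|p c'] /= le IH1; first by rewrite expn1.
by apply: leq_trans IH1; rewrite expnS -mulnA mulnCA leq_mul2l le orbT.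
Qed.

Lemma chain_sparsity h g c : chain_ok h g c -> bound_sparsity c <= a0 + (size c)%:R * u.
Proof.
elim: c => [|x c IH] /=; first by rewrite mul0r addr0.
move=> [_ [_ _ le _] /IH{}IH]; rewrite -natr1 mulrDl mul1r addrA lerD2r.
exact: le_trans IH.
Qed.

(** If all integers of the innermost interval were keys, its weight would be at most [1 + lam] times
    their number; with sparsity at most [amax], its width would then be less than the number of its
    keys. *)
Lemma free_key h g c : well_spread h g -> (M0 <= cnt h rlo rhi)%N -> chain_ok h g c ->
  exists p, [/\ p \in h, (parent_lo c <= p)%N, (p.+1 < parent_hi c)%N & p.+1 \notin h].
Proof.
move=> hg M0c okc; have [ph qh] := parent_in hg okc.
have av_le : bound_sparsity c <= amax.
  apply: le_trans (chain_sparsity okc) _; apply: le_trans amax_ge; rewrite lerD2l ler_wpM2r ?u_ge0//.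
  by rewrite ler_nat (chain_size okc).
have [lh dn] : (parent_lo c < parent_hi c)%N /\
    width g (parent_lo c) (parent_hi c) <= bound_sparsity c * weight h (parent_lo c) (parent_hi c).
  case: (c) okc => [|x c'] okc /=; first by have [] := root_dense hg M0c.
  have [okx _ _] := okc; split; first exact: lo_hi okx.
  have [||| dn wle] := is_robust okx (lo_in okx) (hi_in okx); rewrite ?cntxx ?(used_le okx)//.
  apply: (le_trans dn); rewrite ler_wpM2l// ?addr_ge0 ?u_ge0 ?(sparsity_ge0 okx)//.
  by rewrite gerBl.
set a := parent_lo c in ph lh dn *; set b := parent_hi c in qh lh dn *.
have c0 : (0 : R) < (cnt h a b)%:R by rewrite ltr0n cnt_gt0.
have cw := cnt_le_width hg ph qh (ltnW lh).
have lt : (cnt h a b < b - a)%N.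
  rewrite ltnNge -(ler_nat R) natrB ?(ltnW lh)//; apply/negP => le.
  have e1 : weight h a b <= (1 + lam) * (cnt h a b)%:R.
    by rewrite /weight mulrDl mul1r lerD2l ler_wpM2l.
  have w0 : 0 < weight h a b by apply: lt_le_trans (cnt_le_weight h (ltnW lh)).
  have e2 : bound_sparsity c * weight h a b <= amax * weight h a b by rewrite ler_pM2r.
  have e3 : 0 < amax by rewrite -(pmulr_lgt0 _ w0); lra.
  have e4 : amax * weight h a b <= amax * ((1 + lam) * (cnt h a b)%:R) by rewrite ler_pM2l.
  have : amax * (1 + lam) * (cnt h a b)%:R < 1 * (cnt h a b)%:R by rewrite ltr_pM2r.
  by rewrite mul1r; lra.
have [p [pin ap pb np]] := free_key_ex (ws_uniq hg) ph lt.
exists p; split => //; rewrite ltn_neqAle pb andbT.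
by apply: contraNneq np => ->.
Qed.

Lemma well_spread_cons h g g' p : well_spread h g -> p \in h -> (p.+1 < rhi)%N ->
  p.+1 \notin h -> increasing_on (p.+1 :: h) g' ->
  (forall k, k \in p.+1 :: h -> (g' k < m)%N) -> well_spread (p.+1 :: h) g'.
Proof.
move=> [uh gi sp lh hh rg] ph prh np g'i g'm; split => //=.
- by rewrite np.
- move=> a b; rewrite !inE !cnt_cons => /predU1P[->|ah] /predU1P[->|bh] ab.
  + by rewrite subnn.
  + have pb : (p <= b)%N by natlia.
    have := sp p b ph bh pb.
    have -> : cnt h p b = cnt h p.+1 b.
      rewrite (cnt_split h (leqnSn p) ab) [X in (X + _)%N](_ : _ = 0)%N//.
      by rewrite cnt_recr// cntxx (negbTE np).
    by rewrite ltnn; natlia.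
  + have [e|ap] := eqVneq a p.+1; first by rewrite -e ah in np.
    have ap' : (a <= p)%N by move: ap ab; clear; lia.
    have := sp a p ah ph ap'; have := cnt_split h ap' (leqnSn p).
    rewrite ltn_neqAle ap ab leqnn /= => ->.
    by move: B_gt0; natnia.
  + by apply: leq_trans (sp a b ah bh ab) _; rewrite leq_mul2l leq_addl orbT.
- by rewrite inE lh orbT.
- by rewrite inE hh orbT.
Qed.

Definition load (c : seq level) : R := \sum_(x <- c) (age x)%:R / (slots x)%:R.

Lemma load_cons x c : load (x :: c) = (age x)%:R / (slots x)%:R + load c.
Proof. exact: big_cons. Qed.

(** Add up the score bounds along the chain. A parent is at least twice as large as its child, so
    the credit missed before the birth of the child is at most half the child's own ratio of age to
    size; the other half remains. *)
Lemma score_le h g x c : chain_ok h g (x :: c) ->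
  score (sparsity x) (slots x) + c1 / 2 * load c - c1 / 2 * ((age x)%:R / (slots x)%:R) <= h0 + (size c)%:R * v.
Proof.
elim: c x => [|p c IH] x [okx [le1 le2 _ sc]] okc.
  rewrite /load big_nil mulr0 addr0 mul0r addr0; apply: le_trans sc.
  by rewrite gerBl !mulr_ge0 ?invr_ge0.
have {}IH := IH _ okc; have [okp _ _] := okc.
have -> : (size (p :: c))%:R * v = (size c)%:R * v + v.
  by rewrite (_ : size (p :: c) = (size c).+1)// -natr1 mulrDl mul1r.
rewrite load_cons.
have := thr_le okx; have := thr_le okp => tp tx.
have mp0 : 0 < (slots p)%:R :> R by rewrite ltr0n; natlia.
have mx0 : 0 < (slots x)%:R :> R by rewrite ltr0n; natlia.
have e : (age x)%:R / (slots p)%:R <= (age x)%:R / (slots x)%:R / 2 :> R.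
  rewrite -mulrA -invfM ler_wpM2l// lef_pV2 ?posrE ?mulr_gt0//.
  by rewrite -natrM ler_nat mulnC.
have e' := ler_wpM2l c1_ge0 e.
have sc' : score (sparsity x) (slots x) <= score (sparsity p) (slots p) + v
    - c1 * ((age p)%:R / (slots p)%:R) + c1 * ((age x)%:R / (slots p)%:R).
  apply: (le_trans sc); rewrite /= le_eqVlt; apply/orP; left; apply/eqP; ring.
move: sc' IH e'; move: (score _ _) (score _ _) ((age p)%:R / _) ((age x)%:R / _) ((age x)%:R / _).
by move: (load c) => *; lra.
Qed.

Hypothesis bud_ge0 : 0 <= bud.

Lemma load_le h g c : chain_ok h g c -> exhausted c -> bud + c1 / 2 * load c <= (size c)%:R * v.
Proof.
rewrite /exhausted; case: c => [_|x c okc] ex.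
  by rewrite /load big_nil mulr0 mul0r addr0; move: bud_le ex; rewrite /bound_score; lra.
have -> : (size (x :: c))%:R * v = (size c)%:R * v + v.
  by rewrite (_ : size (x :: c) = (size c).+1)// -natr1 mulrDl mul1r.
have sc := score_le okc; move: ex; rewrite /= subr0 -mulrA => ex.
move: bud_le sc ex; rewrite load_cons.
by move: (score _ _) (_ / (slots x)%:R) (load c) (kap^-1 - _) => *; lra.
Qed.

(** By [load_le] an exhausted chain has at least [bud / v] levels, and their ratios of age to size
    average at most [alpha / 4]. The slope of [earn] is [ce * (1 - age / (alpha * slots))] and
    discretization costs at most [ce / 4], so a level gains [ce / 2] on average. *)
Lemma total_gain_ge h g c : chain_ok h g c -> exhausted c -> ce * (bud / (2 * v)) <= total_gain c.
Proof.
move=> okc ex; have ld := load_le okc ex; have v0 := v_gt0.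
have c10 : 0 < c1 by rewrite -(pmulr_rgt0 _ alpha_gt0) alphaE mulr_gt0.
have ld0 : 0 <= load c by apply: sumr_ge0 => x _; rewrite divr_ge0.
apply: (@le_trans _ _ (ce * (3 / 4 * (size c)%:R - load c / alpha))).
  rewrite ler_wpM2l//.
  have -> : load c / alpha = c1 / 2 * load c / (4 * v).
    have -> : v = alpha * c1 / 8 by rewrite alphaE; field.
    by field; rewrite !gt_eqF.
  have e1 : c1 / 2 * load c / (4 * v) <= ((size c)%:R * v - bud) / (4 * v).
    by rewrite ler_pM2r ?invr_gt0 ?mulr_gt0//; lra.
  have e2 : ((size c)%:R * v - bud) / (4 * v) = (size c)%:R / 4 - bud / (4 * v).
    by field; rewrite gt_eqF.
  have e3 : bud / (2 * v) <= (size c)%:R / 2.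
    rewrite ler_pdivrMr ?mulr_gt0//; have : 0 <= c1 / 2 * load c by rewrite mulr_ge0// divr_ge0 ?ltW.
    by lra.
  have e4 : 0 <= bud / (4 * v) by rewrite divr_ge0// mulr_ge0 ?ltW.
  by lra.
rewrite /total_gain /load; elim: c okc {ex ld ld0} => [|x c IH] okc.
  by rewrite !big_nil mul0r mulr0 subr0 mulr0.
have [okx _ okc'] := okc; rewrite !big_cons; have {}IH := IH okc'.
have mb0 : 0 < (slots x)%:R :> R by rewrite ltr0n; have := thr_le okx; natlia.
have e : ce * (3 / 4 - (age x)%:R / (slots x)%:R / alpha) <= gain x.
  rewrite /gain /earn -mulrBr ler_wpM2l// -[(age x).+1%:R]natr1.
  have -> : (age x)%:R + 1 - ((age x)%:R + 1) ^+ 2 / (2 * alpha * (slots x)%:R) -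
      ((age x)%:R - (age x)%:R ^+ 2 / (2 * alpha * (slots x)%:R))
     = 1 - (age x)%:R / (slots x)%:R / alpha - (2 * (alpha * (slots x)%:R))^-1.
    by field; rewrite !gt_eqF.
  suff : (2 * (alpha * (slots x)%:R))^-1 <= 4^-1 by lra.
  rewrite lef_pV2 ?posrE ?mulr_gt0//.
  have : alpha * thr%:R <= alpha * (slots x)%:R by rewrite ler_pM2l// ler_nat (thr_le okx).
  by move: alpha_thr; move: (alpha * _) (alpha * _) => A1 A2; lra.
apply: le_trans (lerD e IH); rewrite -mulrDr ler_wpM2l//.
rewrite (_ : size (x :: c) = (size c).+1)// -[(size c).+1%:R]natr1 [leLHS](_ : _ = 3 / 4 * (size c)%:R + 3 / 4 -
   (age x)%:R / (slots x)%:R / alpha - (\sum_(j <- c) (age j)%:R / (slots j)%:R) / alpha); last by ring.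
by rewrite le_eqVlt; apply/orP; left; apply/eqP; ring.
Qed.

(** * One step and one phase of the adversary *)

Variables (r n : nat) (Lz : seq nat -> nat -> nat) (LC : seq nat -> nat).
Hypothesis game : lazy_game n m r Lz LC.

(** Complete the chain, which leaves the potential unchanged as new levels have age 0, insert a free
    key into the innermost interval and repair. The moved keys make up for any loss, so the total
    gain is profit. *)
Lemma adversary_step h c : good r n h -> (size h < n)%N -> well_spread h (Lz h) ->
  (M0 <= cnt h rlo rhi)%N -> chain_ok h (Lz h) c ->
  exists y c', [/\ good r n (y :: h), (rlo < y <= rhi)%N, well_spread (y :: h) (Lz (y :: h)),
    chain_ok (y :: h) (Lz (y :: h)) c' &
    (LC h)%:R + total_pot c + ce * (bud / (2 * v)) <= (LC (y :: h))%:R + total_pot c'].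
Proof.
move=> gh sh hg M0c okc0.
have [c' [okc [ex fresh]]] := complete_chain hg M0c okc0.
have [p [ph pp pq np]] := free_key hg M0c okc.
have [pin qin] := parent_in hg okc.
have nested d : chain_ok h (Lz h) d -> (rlo <= parent_lo d)%N && (parent_hi d <= rhi)%N.
  elim: d => [|x d IH] /=; first by rewrite !leqnn.
  by move=> [okx _ /IH]; have := parent_nested okx; case=> *; natlia.
have /andP[lp pr] := nested _ okc.
have [uh /allP rh _] := and3P gh.
have g' : good r n (p.+1 :: h).
  rewrite /good /= np uh sh (leq_ltn_trans _ (rh _ (ws_hi hg))) ?(leq_trans (ltnW pq))//=.
  by rewrite andbT; apply/allP.
have hg' : well_spread (p.+1 :: h) (Lz (p.+1 :: h)).
  apply: (well_spread_cons hg ph) => //; first exact: leq_trans pr.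
    exact: lz_incr game _ g'.
  by move=> k; apply: lz_range game _ _ g'.
have [mv [conv mvy fix_ cost]] := lz_step game g'.
have bet : (parent_lo (c' ++ c) < p.+1 < parent_hi (c' ++ c))%N by rewrite ltnS pp.
have [c2 [okc2 potle]] := repair_chain hg conv mvy fix_ okc bet.
exists p.+1, c2; split => //; first by natlia.
have gle := total_gain_ge okc ex.
have potE : total_pot (c' ++ c) = total_pot c.
  elim: (c') fresh => //= x d IH /andP[/andP[/eqP a0' /eqP u0] /IH{}IH].
  by rewrite total_pot_cons IH /pot a0' u0 /earn expr0n /= mul0r subrr mulr0 subrr add0r.
have : (moved_out h mv (parent_lo (c' ++ c)) (parent_hi (c' ++ c)) <= count mv h)%N.
  by apply: sub_count => k /andP[].
by move: cost potle; rewrite potE -!(ler_nat R) natrD; lra.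
Qed.

Lemma bound_slots_le h g c : chain_ok h g c -> (bound_slots c <= 2 * m)%N.
Proof. by elim: c => //= x c IH [_ [_ le _ _] /IH]; natlia. Qed.

Lemma total_pot_le h g c : chain_ok h g c -> total_pot c <= (size c)%:R * m%:R.
Proof.
elim: c => [|x c IH] okc; first by rewrite /total_pot big_nil mul0r.
have [okx [_ le _ _] okc'] := okc; have := bound_slots_le okc'.
rewrite total_pot_cons (_ : size (x :: c) = (size c).+1)// -[(size c).+1%:R]natr1 mulrDl mul1r addrC => le2.
apply: lerD (IH okc') _; rewrite /pot lerBlDr; apply: le_trans (earn_le _ (thr_le okx)) _.
rewrite -natrD ler_nat; apply: leq_trans (leq_addr _ _); apply: leq_trans (leq_div _ _) _.
by natlia.
Qed.

(** Sum over the steps, starting with the empty chain; the potential left at the end is at most [m]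
    per level. *)
Lemma adversary_phase I h : good r n h -> (size h + I <= n)%N -> well_spread h (Lz h) ->
  (M0 <= cnt h rlo rhi)%N ->
  exists s, [/\ size s = I, all (fun k => rlo < k <= rhi)%N s, good r n (s ++ h),
    well_spread (s ++ h) (Lz (s ++ h)) &
    (LC h)%:R + I%:R * (ce * (bud / (2 * v))) <= (LC (s ++ h))%:R + K%:R * m%:R].
Proof.
move=> gh sI hg M0c.
suff [s [c [[ss rs gs] hs okc le]]] : exists s c,
    [/\ [/\ size s = I, all (fun k => rlo < k <= rhi)%N s & good r n (s ++ h)],
    well_spread (s ++ h) (Lz (s ++ h)), chain_ok (s ++ h) (Lz (s ++ h)) c &
    (LC h)%:R + I%:R * (ce * (bud / (2 * v))) <= (LC (s ++ h))%:R + total_pot c].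
  exists s; split => //; apply: (le_trans le); rewrite lerD2l.
  apply: (@le_trans _ _ ((size c)%:R * m%:R)); last first.
    by rewrite ler_wpM2r// ler_nat (chain_size okc).
  exact: total_pot_le okc.
elim: I sI => [|I IH] sI.
  by exists [::], [::]; split => //=; rewrite mul0r addr0 /total_pot big_nil addr0.
have [|s [c [[ss rs gs] hs okc le]]] := IH; first by natlia.
have [||y [c' [g' ry hs' okc' le']]] := adversary_step gs _ hs _ okc.
- by rewrite size_cat ss; natlia.
- by apply: leq_trans M0c _; rewrite /cnt count_cat leq_addl.
exists (y :: s), c'; split => //; first by rewrite /= ss ry.
by rewrite -natr1 mulrDl mul1r; move: le le'; rewrite /=; lra.
Qed.
End Chain.

(** * Estimates of logarithms *)

Section Logarithm.
Variable R : realType.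

Lemma ln2_ge : 2^-1 <= ln 2 :> R.
Proof.
have := @le_ln1Dx R (- 2^-1); rewrite (_ : 1 + - 2^-1 = 2^-1); last by lra.
by rewrite lnV ?posrE// => /(_ _)/wrap[]; lra.
Qed.

Lemma ln_le_sqrt (x : R) : 0 < x -> ln x <= 2 * Num.sqrt x.
Proof.
move=> x0; have s0 : 0 < Num.sqrt x by rewrite sqrtr_gt0.
rewrite -[in leLHS](sqr_sqrtr (ltW x0)) lnXn// -[ln _ *+ _]mulr_natl ler_pM2l//.
exact: ltW (ln_sublinear s0).
Qed.

Lemma ln_dominated (C : R) : exists W : nat, (8 <= W)%N /\ C * ln (2 * W)%:R <= W%:R.
Proof.
have [t t2 tC] : exists2 t, (2 <= t)%N & 2 * C <= t%:R.
  exists (Num.Def.archi_bound (2 * C)).+2 => //.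
  apply: (le_trans (ltW (unstable.ltr_bound _))); rewrite ler_nat.
  exact: leq_trans (leqnSn _) (leqnSn _).
(* This works since [ln (4 * t ^ 2) <= 4 * t] and [2 * C <= t]. *)
exists (2 * t ^ 2)%N; split; first by nia.
have t0 : 0 <= t%:R :> R by [].
have e : ln (2 * (2 * t ^ 2))%:R <= 4 * t%:R :> R.
  have -> : (2 * (2 * t ^ 2) = (2 * t) ^ 2)%N by rewrite mulnA -[(2 * 2)%N]/(2 ^ 2)%N -expnMn.
  apply: (le_trans (ln_le_sqrt _)); first by rewrite ltr0n expn_gt0 muln_gt0 (ltnW t2).
  by rewrite natrX sqrtr_sqr ger0_norm ?natrM//; lra.
have l0 : 0 <= ln (2 * (2 * t ^ 2))%:R :> R by rewrite ln_ge0// ler1n; nia.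
have [C0|C0] := lerP 0 C; last first.
  by apply: le_trans (_ : 0 <= _)%R => //; rewrite nmulr_rle0.
apply: (le_trans (ler_wpM2l C0 e)); rewrite natrM natrX.
have := ler_wpM2r t0 tC; rewrite expr2; lra.
Qed.

End Logarithm.

(** * The parameters of a phase *)

Section PhaseCost.
Variable R : realType.

(** [G] cells are free at the start and at least [G / 6] keys are inserted. The profit of an
    insertion is of order [m * ln m ^ 2 / G], so that of the phase does not depend on [G]. *)
Lemma phase_cost : exists L0 c : R, 0 < c /\
  forall (m n r N0 G I : nat) (Lz : seq nat -> nat -> nat) (LC : seq nat -> nat) (h : seq nat),
  lazy_game n m r Lz LC ->
  L0 <= ln m%:R -> (m <= 5 * N0)%N -> (0 < N0 < size h)%N -> (size h + G = m)%N ->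
  Num.sqrt (Num.sqrt m%:R) ^+ 3 <= G%:R :> R -> (0 < G <= 6 * I)%N ->
  good r n h -> (size h + I <= n)%N -> well_spread 64 m 0 (64 * N0) h (Lz h) ->
  ((size h).-1 <= cnt h 0 (64 * N0))%N ->
  exists s, [/\ size s = I, all (fun k => 0 < k <= 64 * N0)%N s, good r n (s ++ h),
    well_spread 64 m 0 (64 * N0) (s ++ h) (Lz (s ++ h)) &
    (LC h)%:R + c * (m%:R * ln m%:R ^+ 2) <= (LC (s ++ h))%:R :> R].
Proof.
(* Large numerals are made opaque, since they are unary. *)
have [e0 EE] : exists e0 : R, e0 = 504 * 320 by exists (504 * 320).
have [W [W8 lnW]] := ln_dominated e0.
have W0 : 0 < W%:R :> R by rewrite ltr0n; natlia.
(* [441 = 21 ^ 2] bounds [kap ^ 2], so [c1] can be [1 / 441]; with [alpha = k * tau] this makes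
   [alpha * c1] equal to [64 * tau = 8 * v]. *)
have [k [k1 k441]] : exists k : R, 1 <= k /\ k / 441 = 64.
  by exists (64 * 441); split; [apply: mulr_ege1; rewrite ler1n|rewrite mulfK ?pnatr_eq0].
have k0 : 0 < k by ordlra.
pose C : R := W%:R * k * 1024.
have [C' CE'] : exists C', C' = 720 * C by exists (720 * C).
exists (2 * W%:R + 4 + C'), (240 * C)^-1.
have C0 : 0 < C by rewrite /C; apply: mulr_gt0; [apply: mulr_gt0|rewrite ltr0n].
have C'0 : 0 < C' by rewrite CE'; apply: mulr_gt0; rewrite ?ltr0n.
split; first by rewrite invr_gt0; apply: mulr_gt0; rewrite ?ltr0n.
move=> m n r N0 G I Lz LC h game Lm mN /andP[N00 N0h] hGm qG /andP[G0 GI] gh hI hs hc.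
set L : R := ln m%:R in Lm *.
set q := Num.sqrt (Num.sqrt m%:R) in qG.
have m0 : (0 < m)%N by natlia.
have m0' : 0 < m%:R :> R by rewrite ltr0n.
have q0 : 0 < q by rewrite !sqrtr_gt0.
have q2 : q ^+ 2 = Num.sqrt m%:R by rewrite sqr_sqrtr// sqrtr_ge0.
have q4 : q ^+ 4 = m%:R by rewrite -[4%N]/(2 * 2)%N exprM q2 sqr_sqrtr.
have W8' : 8 <= W%:R :> R by rewrite ler_nat.
have Lq2 : L <= 2 * q ^+ 2 by rewrite q2; apply: ln_le_sqrt.
have Lq : L <= 4 * q.
  rewrite /L -q4 lnXn// -[ln _ *+ _]mulr_natl ler_pM2l//; exact: ltW (ln_sublinear q0).
have L0 : 0 < L by ordlra.
have N0' : 0 < N0%:R :> R by rewrite ltr0n.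
have G0' : 0 < G%:R :> R by rewrite ltr0n.
have g1 : 1 <= G%:R :> R by rewrite ler1n.
have mN' : m%:R <= 5 * N0%:R :> R by rewrite -natrM ler_nat.
have gm : G%:R <= m%:R :> R by rewrite ler_nat; natlia.
(* The root's least weight at the start: [(size h).-1] keys, as the half-open interval misses the
   key 0, and [4 * G] from the [lam] term. *)
pose D : R := m%:R + 3 * G%:R - 1.
have D0 : 0 < D by rewrite /D; ordlra.
have mD : m%:R <= D by rewrite /D; ordlra.
have Dm : D <= 4 * m%:R by rewrite /D; ordlra.
pose kap : R := 1 + 4 * G%:R / N0%:R.
pose lam : R := 4 * G%:R / N0%:R / 64.
pose bud : R := 20 * G%:R / D.
(* From [M0] down to [thr] keys the logarithm falls by at least [L / 4], so this price raises the
   score by [2 * bud], of which the sparsity uses up at most [a0 - kap^-1 <= bud]. *)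
pose tau : R := 8 * bud / L.
pose u : R := 168 * tau * ln (2 * W)%:R / W%:R.
pose v : R := 8 * tau.
pose alpha : R := k * tau.
(* The parabola [earn] peaks at age [alpha * M] with value [M / (2 * W)], which is at most
   [M %/ W]. *)
pose ce : R := (W%:R * alpha)^-1.
pose a0 : R := m%:R / D.
pose amax : R := a0 + G%:R / (2 * D).
pose M0 := (size h).-1.
pose thr := Num.Def.trunc (Num.sqrt m%:R : R).
pose K := (trunc_log 2 m).+1.
have bud0 : 0 < bud by rewrite /bud divr_gt0// mulr_gt0//; ordlra.
have tau0 : 0 < tau by rewrite /tau divr_gt0// mulr_gt0.
have lnW0 : 0 <= ln (2 * W)%:R :> R by rewrite ln_ge0// ler1n; natlia.
have gN : 4 * G%:R / N0%:R <= 20 :> R by rewrite ler_pdivrMr//; ordlra.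
have gN0 : 0 <= 4 * G%:R / N0%:R :> R by rewrite divr_ge0// mulr_ge0.
have u0 : 0 <= u by rewrite /u; apply: divr_ge0; [apply: mulr_ge0; [apply: mulr_ge0; [rewrite ler0n|exact: ltW]|]|exact: ltW].
have KL : K%:R <= 3 * L.
  have : (2 ^ trunc_log 2 m <= m)%N by apply: trunc_logP.
  rewrite -(ler_nat R) natrX -ler_ln ?posrE ?exprn_gt0// lnXn// -[ln _ *+ _]mulr_natl -/L => e.
  rewrite /K -natr1; have l2 := ln2_ge R.
  have t0 : 0 <= (trunc_log 2 m)%:R :> R by [].
  have := ler_wpM2l t0 l2; ordlra.
have [thr_le thr_gt] : thr%:R <= q ^+ 2 /\ q ^+ 2 < thr%:R + 1.
  rewrite q2; have /truncn_itv/andP[e1 e2] : 0 <= Num.sqrt m%:R :> R by exact: sqrtr_ge0.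
  by rewrite natr1.
have thrW : (W <= thr)%N by rewrite -(ler_nat R); ordlra.
have Ku : K%:R * u <= G%:R / (2 * D).
  apply: (le_trans (ler_wpM2r u0 KL)).
  have -> : 3 * L * u = 504 * (160 * (G%:R / D * (ln (2 * W)%:R / W%:R))).
    by rewrite /u /tau /bud; field; rewrite !gt_eqF.
  have -> : G%:R / (2 * D) = G%:R / D / 2 by field; rewrite gt_eqF.
  have GD0 : 0 <= G%:R / D by rewrite divr_ge0// ltW.
  have : e0 * (ln (2 * W)%:R / W%:R) <= 1 :> R by rewrite !mulrA ler_pdivrMr// mul1r.
  move=> /(ler_wpM2l GD0); rewrite EE; move: (G%:R / D) (_ / W%:R); clear => x y; lra.
(* Here [G >= m ^ (3 / 4)] is needed: sparsity differences must not vanish at the scale of the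
   smallest levels. *)
have tauq : 10 <= tau * q ^+ 2.
  rewrite /tau /bud (_ : _ * _ = 160 * G%:R * q ^+ 2 / (D * L)); last by field; rewrite !gt_eqF.
  rewrite ler_pdivlMr ?(mulr_gt0 D0 L0)//.
  have e1 : D * L <= 4 * q ^+ 4 * (4 * q).
    by rewrite q4; apply: ler_pM; rewrite ?(ltW D0) ?(ltW L0).
  have e2 : q ^+ 3 * q ^+ 2 <= G%:R * q ^+ 2 by rewrite ler_wpM2r// exprn_ge0// ltW.
  have -> : 160 * G%:R * q ^+ 2 = 160 * (G%:R * q ^+ 2) by ring.
  move: e2; rewrite (_ : q ^+ 3 * q ^+ 2 = q ^+ 4 * q); last by ring.
  by move=> e2; ordlra.
have tauthr : 2 <= alpha * thr%:R.
  have : q ^+ 2 / 2 <= thr%:R by ordlra.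
  move=> /(ler_wpM2l (ltW tau0)) e.
  have e' : 5 <= tau * thr%:R.
    by move: tauq e; rewrite mulrA; move: (tau * q ^+ 2) (tau * thr%:R); clear => x y; lra.
  rewrite /alpha -mulrA; have := ler_pM _ _ k1 e'; rewrite ler01 ler0n => /(_ isT isT); move: (k * _); clear => x; lra.
have thr0 : (0 < thr)%N by natlia.
have N0M0 : (N0 <= M0)%N by rewrite /M0; natlia.
have M00 : (0 < M0)%N by natlia.
have lnM0 : 2 * bud <= tau * (ln M0%:R - ln thr%:R).
  have e1 : ln thr%:R <= L / 2.
    have : ln thr%:R <= ln (q ^+ 2) by rewrite ler_ln ?posrE ?ltr0n ?exprn_gt0//; ordlra.
    have : L = ln (q ^+ 2) *+ 2 by rewrite -lnXn ?exprn_gt0// -exprM q4.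
    by rewrite mulr2n; ordlra.
  have e2 : L <= ln 5 + ln M0%:R.
    rewrite -lnM ?posrE ?ltr0n// ler_ln ?posrE ?mulr_gt0 ?ltr0n//.
    by apply: (le_trans mN'); rewrite ler_pM2l// ler_nat.
  have e3 : ln 5 <= 5 :> R by apply: ltW; apply: ln_sublinear.
  have -> : 2 * bud = tau * (L / 4) by rewrite /tau; field; rewrite gt_eqF.
  by rewrite ler_pM2l//; ordlra.
have kapV : kap^-1 = N0%:R / (N0%:R + 4 * G%:R).
  by rewrite /kap; field; rewrite !gt_eqF//; ordlra.
have a0E : a0 - kap^-1 <= bud.
  rewrite kapV lerBlDr addrC -lerBlDr /a0 /bud -mulrBl ler_pdivrMr//.
  rewrite mulrAC ler_pdivlMr; last by ordlra.
  rewrite /D.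
  have e1 : G%:R * m%:R <= G%:R * (5 * N0%:R) :> R by rewrite ler_wpM2l.
  have e2 : N0%:R * 1 <= N0%:R * G%:R :> R by rewrite ler_wpM2l.
  have e3 : 0 <= G%:R * G%:R :> R by rewrite mulr_ge0.
  by clear - e1 e2 e3 N0'; lra.
have kap21 : kap <= 21 by rewrite /kap; ordlra.
have kap1 : 1 <= kap by rewrite /kap; ordlra.
have alpha0 : 0 < alpha by rewrite /alpha mulr_gt0.
have lam0 : 0 <= lam by rewrite /lam divr_ge0.
have kapE : kap = 1 + lam * 64%:R by rewrite /kap /lam; field; rewrite gt_eqF.
have u_ge : 8 * (tau * ln (2 * W)%:R) * kap <= u * W%:R.
  rewrite /u divfK ?gt_eqF//.
  have e : 0 <= tau * ln (2 * W)%:R by rewrite mulr_ge0// ltW.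
  have := ler_wpM2l e kap21; ordlra.
have v_ge : u + tau * ln 8 <= v.
  have e1 : u <= tau.
    rewrite /u ler_pdivrMr// -mulrA (mulrCA 168) ler_pM2l//.
    by move: lnW lnW0; rewrite EE; move: (ln _) (W%:R); clear => x y; lra.
  have e2 : ln 8 <= 7 :> R.
    by have := @le_ln1Dx R 7; rewrite (_ : 1 + 7 = 8); [apply; ordlra|ring].
  have := ler_wpM2l (ltW tau0) e2; rewrite /v; ordlra.
have c1_ge : 0 <= 441^-1 :> R by rewrite invr_ge0 ler0n.
have c1_le : 441^-1 * kap ^+ 2 <= 1.
  rewrite mulrC ler_pdivrMr ?ltr0n// mul1r (_ : 441%N = (21 * 21)%N)// natrM expr2.
  have kap0 : 0 <= kap by apply: le_trans kap1.
  exact: ler_pM.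
have earn_le (j M : nat) : (thr <= M)%N -> earn alpha ce j M <= (M %/ W)%:R.
  move=> thrM; have WM : (W <= M)%N by exact: leq_trans thrM.
  have M0' : 0 < M%:R :> R by rewrite ltr0n; natlia.
  rewrite /earn; set A := alpha * M%:R.
  have A0 : 0 < A by rewrite mulr_gt0.
  have e1 : j%:R - j%:R ^+ 2 / (2 * alpha * M%:R) <= A / 2.
    have -> : j%:R - j%:R ^+ 2 / (2 * alpha * M%:R) = A / 2 - (j%:R - A) ^+ 2 / (2 * A).
      by rewrite /A; field; rewrite !gt_eqF.
    by rewrite gerBl divr_ge0 ?sqr_ge0// mulr_ge0// ltW.
  have ce0 : 0 <= ce by rewrite invr_ge0 mulr_ge0// ltW.
  apply: (le_trans (ler_wpM2l ce0 e1)).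
  have -> : ce * (A / 2) = M%:R / (2 * W%:R) by rewrite /ce /A; field; rewrite !gt_eqF.
  rewrite ler_pdivrMr ?mulr_gt0// -!natrM ler_nat.
  have W00 : (0 < W)%N by exact: leq_trans W8.
  have d0 : (0 < M %/ W)%N by rewrite divn_gt0.
  apply: leq_trans (ltnW (ltn_ceil M W00)) _.
  by rewrite mulnA leq_mul2r muln2 -addnn -addn1 leq_add2l d0 orbT.
have lt_mK : (m < 2 ^ K)%N by apply: trunc_log_ltn.
have M0E : M0%:R + 4 * G%:R = D.
  rewrite /D -hGm natrD; have -> : (size h)%:R = M0%:R + 1 :> R by rewrite natr1 prednK//; natlia.
  by ring.
have a0_root : m%:R <= a0 * (M0%:R + lam * ((64 * N0)%:R - 0%:R)).
  have -> : lam * ((64 * N0)%:R - 0%:R) = 4 * G%:R.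
    by rewrite /lam natrM subr0; field; rewrite gt_eqF.
  by rewrite M0E /a0 divfK ?gt_eqF.
have a0_ge : 0 <= a0 by rewrite divr_ge0 ?(ltW D0).
have amax_ge : a0 + K%:R * u <= amax by rewrite lerD2l.
have amax_free : amax * (1 + lam) < 1.
  have -> : amax = (2 * m%:R + G%:R) / (2 * D) by rewrite /amax /a0; field; rewrite gt_eqF.
  have -> : 1 + lam = (16 * N0%:R + G%:R) / (16 * N0%:R) by rewrite /lam; field; rewrite gt_eqF.
  rewrite mulf_div ltr_pdivrMr ?mul1r ?mulr_gt0// /D.
  have e1 : G%:R * m%:R <= G%:R * (5 * N0%:R) :> R by rewrite ler_wpM2l.
  have e2 : N0%:R * 1 <= N0%:R * G%:R :> R by rewrite ler_wpM2l.
  have e3 : G%:R * G%:R <= G%:R * (5 * N0%:R) :> R by rewrite ler_wpM2l// (le_trans gm).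
  by clear - e1 e2 e3 G0' N0'; lra.
have bud_le : bud + score tau a0 M0 <= kap^-1 - tau * ln thr%:R.
  by rewrite /score; move: lnM0; rewrite mulrBr; ordlra.
have alphaE : alpha * 441^-1 = 8 * v by rewrite /alpha mulrAC k441 /v; ring.
have ce0 : 0 <= ce by rewrite invr_ge0 mulr_ge0// ltW.
have [s [e1 e2 e3 e4 le]] := @adversary_phase R 64 W thr m 0 (64 * N0) lam tau u v (441^-1) kap a0
  (score tau a0 M0) lam0 kapE tau0 W8 thrW u_ge v_ge c1_ge c1_le alpha ce earn_le M0 K amax bud
  m0 isT M00 lt_mK a0_root (lexx _) a0_ge amax_ge amax_free bud_le alpha0 alphaE ce0 tauthr
  (ltW bud0) r n Lz LC game I h gh hI hs hc.
exists s; split => //.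
suff : (240 * C)^-1 * (m%:R * L ^+ 2) + K%:R * m%:R <= I%:R * (ce * (bud / (2 * v))).
  by move: le; move: (_^-1 * _) (K%:R * _) (I%:R * _) => x y z; clear => *; lra.
have -> : ce * (bud / (2 * v)) = L ^+ 2 * D / (20 * G%:R * C).
  by rewrite /ce /v /alpha /tau /C /bud; field; rewrite !gt_eqF.
have e5 : m%:R * L ^+ 2 / (120 * C) <= I%:R * (L ^+ 2 * D / (20 * G%:R * C)).
  have GI' : G%:R <= 6 * I%:R :> R by rewrite -natrM ler_nat.
  have GC : 0 < 20 * G%:R * C by apply: mulr_gt0; [apply: mulr_gt0; rewrite ?ltr0n|exact: C0].
  rewrite mulrA ler_pdivlMr//.
  have -> : m%:R * L ^+ 2 / (120 * C) * (20 * G%:R * C) = L ^+ 2 * (m%:R * G%:R / 6).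
    by field; rewrite gt_eqF.
  rewrite [leRHS](_ : _ = L ^+ 2 * (I%:R * D)); last by ring.
  rewrite ler_pM2l ?exprn_gt0//.
  have : G%:R * m%:R <= 6 * I%:R * D :> R by apply: ler_pM; rewrite ?ler0n.
  by ordlra.
have C240 : 0 < 240 * C by apply: mulr_gt0; rewrite ?ltr0n.
have e6 : K%:R * m%:R <= 3 * L * m%:R by rewrite ler_wpM2r.
(* For [L >= 720 * C] the potential left over is at most half of the profit. *)
have e7 : 3 * L * m%:R <= m%:R * L ^+ 2 / (240 * C).
  rewrite ler_pdivlMr//.
  have le7 : 720 * C <= L by rewrite -CE'; clear - Lm W0; lra.
  have Lm0 : 0 <= L * m%:R by rewrite mulr_ge0// ltW.
  rewrite [leLHS](_ : _ = L * m%:R * (720 * C)); last by ring.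
  by rewrite [leRHS](_ : _ = L * m%:R * L) ?ler_wpM2l//; ring.
have -> : (240 * C)^-1 * (m%:R * L ^+ 2) = m%:R * L ^+ 2 / (120 * C) - m%:R * L ^+ 2 / (240 * C).
  by field; rewrite gt_eqF.
move: e5 e6 e7; move: (_ / (120 * C)) (_ / (240 * C)) (I%:R * _) (K%:R * _) (3 * L * _).
by clear => *; lra.
Qed.
End PhaseCost.

(** * From algorithms to lazy games *)

Lemma card_set_in_count (T : finType) (s : seq T) (P : pred T) : uniq s ->
  #|[set k in s | P k]| = count P s.
Proof.
move=> us; rewrite -size_filter -(card_uniqP (filter_uniq P us)).
by apply: eq_card => k; rewrite !inE mem_filter andbC.
Qed.

Section Interface.
Variables (n m r' : nat).
Let r := r'.+1.
Variable A : algorithm r m.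
Hypothesis vA : valid_algorithm n A.

Definition keys (h : seq nat) : seq 'I_r := [seq inord k | k <- rev h].
Definition storage (h : seq nat) (k : nat) : nat := A (keys h) (inord k).

Lemma good_drop i h : good r n h -> good r n (drop i h).
Proof.
case/and3P=> uh rh sh; rewrite /good drop_uniq// size_drop (leq_trans (leq_subr _ _))// andbT.
by apply/allP => k /mem_drop; apply: (allP rh).
Qed.

Lemma inord_inj_in h : good r n h -> {in h &, injective (fun k => inord k : 'I_r)}.
Proof.
case/and3P=> _ /allP rh _ a b ah bh /(congr1 val).
by rewrite /= !inordK ?rh.
Qed.

Lemma keys_uniq h : good r n h -> uniq (keys h).
Proof.
move=> gh; rewrite map_inj_in_uniq ?rev_uniq; first by case/and3P: gh.
by move=> a b; rewrite !mem_rev => ah bh; apply: (inord_inj_in gh).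
Qed.

Lemma storage_increasing h : good r n h -> increasing_on h (storage h).
Proof.
move=> gh x y xh yh xy; have /and3P[_ /allP rh sh] := gh.
have inh k : k \in h -> inord k \in keys h.
  by move=> kh; apply: map_f; rewrite mem_rev.
apply: (vA (keys_uniq gh)); rewrite ?size_map ?size_rev ?inh//.
by rewrite !inordK ?rh.
Qed.

Lemma lazy_game_of : lazy_game n m r (lazy storage) (lazy_cost storage).
Proof.
split.
- by move=> h gh; apply: lazy_increasing => i; apply: storage_increasing; apply: good_drop.
- by move=> h k _ _; apply: lazy_range => i _; exact: ltn_ord.
move=> y h gyh; exists (pushed h y (storage (y :: h)) (lazy storage h)); split => //.
- exact: pushed_between.
- exact: pushed_self.
by move=> k _ /negbTE /= ->.
Qed.

Lemma cost_total (y : n.-tuple 'I_r) : uniq y ->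
  total_cost A y = cost storage (rev [seq val k | k <- y]).
Proof.
move=> uy; pose s := [seq val k | k <- y].
have keysE t : keys (rev (take t s)) = take t y.
  by rewrite /keys revK -map_take -map_comp -[RHS]map_id; apply: eq_map => k /=; rewrite inord_val.
suff H t : (t <= n)%N -> cost storage (rev (take t s)) = (\sum_(i < n | i < t) #|relocated A y i|)%N.
  have := H n (leqnn n); rewrite take_oversize ?size_map ?size_tuple// => ->.
  by apply: eq_bigl => i; rewrite ltn_ord.
elim: t => [|t IH] tn; first by rewrite take0 /= big_pred0.
rewrite (bigD1 (Ordinal tn)) //=.
rewrite [X in (_ + X)%N](_ : _ = (\sum_(i < n | i < t) #|relocated A y i|)%N); last first.
  apply: eq_bigl => i; rewrite ltnS leq_eqVlt -val_eqE /=.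
  by case: ltngtP.
rewrite -IH ?(ltnW tn)//.
have ts : (t < size s)%N by rewrite size_map size_tuple.
have sE : rev (take t.+1 s) = nth 0%N s t :: rev (take t s) by rewrite (take_nth 0%N)// rev_rcons.
rewrite sE /cost -/cost -sE addnC; congr (_ + _)%N.
rewrite count_rev /relocated card_set_in_count ?take_uniq//.
rewrite /s -map_take count_map; apply: eq_count => k /=.
rewrite /storage !keysE inord_val; congr (_ || _).
  rewrite (nth_map k) ?size_tuple// (tnth_nth k) /=.
  by rewrite -val_eqE.
by rewrite map_take -/s keysE.
Qed.

End Interface.

(** Play against the lazy version of an optimal algorithm; its cost is not larger. *)
Lemma chi_lower_bound (R : realType) (b : R) (n m r : nat) :
  (0 < n <= m)%N -> (0 < r)%N ->
  (forall Lz LC, lazy_game n m r Lz LC ->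
    exists h, [/\ good r n h, size h = n & b <= (LC h)%:R]) ->
  b <= (chi n m r)%:R.
Proof.
move=> nm; case: r => // r' _ H.
have [[A vA <-] _] := chiP r'.+1 nm.
have [h [gh sh bh]] := H _ _ (lazy_game_of vA).
apply: (le_trans bh); rewrite ler_nat.
have ty : size (keys r' h) == n by rewrite size_map size_rev sh.
pose y := Tuple ty.
have uy : uniq y by apply: (keys_uniq gh).
have [uh /allP rh _] := and3P gh.
apply: leq_trans (_ : total_cost A y <= _)%N; last exact: (leq_bigmax_cond y).
rewrite cost_total//.
have -> : rev [seq val k | k <- y] = h.
  rewrite /= /keys -map_comp -[RHS]revK; congr rev; rewrite -[RHS]map_id.
  by apply/eq_in_map => k; rewrite mem_rev => /rh kr; rewrite /= inordK.
exact: leq_trans (leq_addr _ _) (lazy_cost_lag _ uh).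
Qed.

Lemma good_complete n m r Lz LC (h : seq nat) : lazy_game n m r Lz LC -> (n <= r)%N ->
  good r n h -> exists h', [/\ good r n h', size h' = n & (LC h <= LC h')%N].
Proof.
move=> lg nr gh; have [k] := ubnP (n - size h); elim: k h gh => // k IH h gh lt.
have [uh rh sh] := and3P gh.
have [e|ne] := eqVneq (size h) n; first by exists h.
have [y yr yh] : exists2 y, (y < r)%N & y \notin h.
  apply: contrapT => none.
  suff : (size (iota 0 r) <= size h)%N by rewrite size_iota; move: sh nr ne; clear; lia.
  apply: uniq_leq_size (iota_uniq 0 r) _ => y; rewrite mem_iota /= add0n => yr.
  by apply/negPn/negP => yh; apply: none; exists y.
have sh' : (size h < n)%N by rewrite ltn_neqAle ne.
have gh' : good r n (y :: h) by rewrite /good /= yh uh yr rh.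
have [|h' [gh'' sh'' le]] := IH _ gh'; first by rewrite /=; move: lt sh'; clear; lia.
have [mv [_ _ _ c]] := lz_step lg gh'.
by exists h'; split => //; apply: leq_trans le; apply: leq_trans c; apply: leq_addr.
Qed.

(** * The initial keys and the sequence of phases *)

Definition grid (N : nat) : seq nat := [seq 64 * j | j <- iota 0 N.+1]%N.

Lemma mem_grid N j : (j <= N)%N -> (64 * j)%N \in grid N.
Proof. by move=> jN; apply: map_f; rewrite mem_iota. Qed.

Lemma grid_spacing N a b : a \in grid N -> b \in grid N -> (a <= b)%N ->
  (b - a <= 64 * cnt (grid N) a b)%N.
Proof.
move=> /mapP[i + ->] /mapP[j + ->]; rewrite !mem_iota /= !add0n => iN jN _.
rewrite -mulnBr leq_mul2l /= /cnt count_map -size_filter -[X in (X <= _)%N](size_iota i.+1).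
apply: uniq_leq_size (iota_uniq _ _) _ => k; rewrite mem_iota => kij.
by rewrite mem_filter mem_iota /=; move: kij iN jN; clear; lia.
Qed.

Lemma grid_good N n r : (64 * N < r)%N -> (N < n)%N -> good r n (grid N).
Proof.
move=> Nr Nn; rewrite /good size_map size_iota Nn andbT map_inj_uniq; last first.
  by move=> a b /eqP; rewrite eqn_mul2l => /eqP.
rewrite iota_uniq andTb; apply/allP => k /mapP[j + ->]; rewrite mem_iota => jN.
by move: jN Nr; clear; lia.
Qed.

(** A phase fills a third of the [G] free cells, rounded down, so [k] phases fit while
    [(3 / 2) ^ k * X <= G]. Here [X] is at least the number of cells free at the end of the game and
    at least the smallest [G] that a phase can handle. *)
Lemma phases (R : realType) : exists L0 c : R, 0 < c /\
  forall (m n r N0 : nat) Lz LC (X : R) (k : nat) (h : seq nat) (G : nat),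
  lazy_game n m r Lz LC -> L0 <= ln m%:R -> (n <= m)%N ->
  (m <= 5 * N0)%N -> (0 < N0 < size h)%N -> (size h + G = m)%N ->
  Num.sqrt (Num.sqrt m%:R) ^+ 3 <= X -> 3 <= X -> (m - n)%:R <= X ->
  (3 / 2) ^+ k * X <= G%:R ->
  good r n h -> well_spread 64 m 0 (64 * N0) h (Lz h) ->
  ((size h).-1 <= cnt h 0 (64 * N0))%N ->
  exists s, good r n (s ++ h) /\
    (LC h)%:R + k%:R * (c * (m%:R * ln m%:R ^+ 2)) <= (LC (s ++ h))%:R.
Proof.
have [L0 [c [c0 H]]] := phase_cost R; exists L0, c; split => //.
move=> m n r N0 Lz LC X k h G lg Lm nm mN; elim: k h G => [|k IH] h G Nh hG qX X3 FX kG gh hs hc.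
  by exists [::]; rewrite mul0r addr0.
set K := c * _ in IH *.
have X0 : 0 < X by lra.
have p1 : 1 <= (3 / 2) ^+ k :> R by rewrite exprn_ege1//; lra.
have kG' : (3 / 2) * ((3 / 2) ^+ k * X) <= G%:R by rewrite mulrA -exprS.
have XX : X <= (3 / 2) ^+ k * X by rewrite ler_peMl// ltW.
have XG : X * (3 / 2) <= G%:R by lra.
pose I := (G %/ 3)%N.
have G4 : (4 < G)%N by rewrite -(ltr_nat R); lra.
have GI : (0 < G <= 6 * I)%N by rewrite /I; move: G4; clear; lia.
have I3 : (3 * I <= G)%N by rewrite /I; move: G4; clear; lia.
have IG : (I <= G)%N by move: I3; clear; lia.
have GIR : (3 / 2) ^+ k * X <= (G - I)%:R.
  have : 3 * I%:R <= G%:R :> R by rewrite -natrM ler_nat.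
  by rewrite natrB//; lra.
have hI : (size h + I <= n)%N.
  have : (m - n <= G - I)%N by rewrite -(ler_nat R); lra.
  by move: hG IG nm; clear; lia.
have [|s [sI sr gs ws le]] := H m n r N0 G I Lz LC h lg
  Lm mN Nh hG _ GI gh hI hs hc; first by lra.
have Nh' : (0 < N0 < size (s ++ h))%N by rewrite size_cat; move: Nh; clear; lia.
have hG' : (size (s ++ h) + (G - I) = m)%N by rewrite size_cat sI; move: hG IG; clear; lia.
have hc' : ((size (s ++ h)).-1 <= cnt (s ++ h) 0 (64 * N0))%N.
  have -> : cnt (s ++ h) 0 (64 * N0) = (I + cnt h 0 (64 * N0))%N.
    by rewrite -sI /cnt count_cat; congr (_ + _)%N; apply/eqP; rewrite -all_count.
  by rewrite size_cat sI; move: hc Nh; clear; lia.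
have [s' [gs' le']] := IH (s ++ h) (G - I)%N Nh' hG' qX X3 FX GIR gs ws hc'.
exists (s' ++ s); rewrite -catA; split => //.
move: le le'; clear IH; rewrite -/K -natr1 mulrDl mul1r; clearbody K.
by move: (k%:R * K) => kK e1 e2; clear - e1 e2; lra.
Qed.

(** [X] is the maximum of [m - n] and [m ^ (3 / 4)], and [k] the integer part of the logarithm of
    [G / X] to base [3 / 2]. If the second term prevails, the number of phases is still of order
    [ln m], which is enough as [ln (m / (m - n)) <= ln m]. *)
Lemma log_phases (R : realType) (m n : nat) : (100 <= n)%N -> (n < m)%N -> (m < 2 * n)%N ->
  exists (X : R) (k : nat), [/\ Num.sqrt (Num.sqrt m%:R) ^+ 3 <= X :> R, 3 <= X, (m - n)%:R <= X,
    (3 / 2) ^+ k * X <= (m - n./2)%:R & ln (m%:R / (m - n)%:R) <= 8 * k%:R :> R].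
Proof.
move=> n100 nm m2n.
pose q : R := Num.sqrt (Num.sqrt m%:R).
have q4 : q ^+ 4 = m%:R by rewrite -[4%N]/(2 * 2)%N exprM !sqr_sqrtr ?sqrtr_ge0.
have q0 : 0 <= q by exact: sqrtr_ge0.
have q3 : 3 <= q.
  rewrite -(@ler_pXn2r _ 4) ?nnegrE// q4.
  by rewrite -natrX ler_nat (leq_trans _ (leq_trans n100 (ltnW nm))).
have q0' : 0 < q by lra.
have q3' : 0 < q ^+ 3 by rewrite exprn_gt0.
pose F : R := (m - n)%:R.
have F1 : 1 <= F by rewrite ler1n subn_gt0.
pose G : R := (m - n./2)%:R.
have FG : 3 * F <= 2 * G.
  by rewrite -!natrM ler_nat; move: n100 nm m2n; clear; lia.
have mG : m%:R <= 2 * G.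
  by rewrite -natrM ler_nat; move: n100 nm m2n; clear; lia.
have Gm : G <= m%:R by rewrite ler_nat leq_subr.
have m0 : 0 < m%:R :> R by rewrite -q4 exprn_gt0.
have G0 : 0 < G by lra.
have mq : m%:R = q * q ^+ 3 by rewrite -q4 exprS.
have qm : 3 * q ^+ 3 <= m%:R by rewrite mq ler_pM2r.
pose X := Num.max F (q ^+ 3).
have [FX qX] : F <= X /\ q ^+ 3 <= X by rewrite !le_max !lexx orbT.
have X0 : 0 < X by lra.
have q27 : 3 <= q ^+ 3.
  have : 3 ^+ 3 <= q ^+ 3 by rewrite ler_pXn2r ?nnegrE.
  by apply: le_trans; rewrite -natrX ler_nat.
have XG : 3 * X <= 2 * G.
  by rewrite /X maxEle; case: ifP => _; lra.
have l0 : 0 < ln (3 / 2) :> R by rewrite ln_gt0//; lra.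
have l1 : ln (3 / 2) <= 2^-1 :> R.
  have := @le_ln1Dx R (2^-1); rewrite (_ : 1 + 2^-1 = 3 / 2); last by field.
  by apply; lra.
have GX0 : 0 < G / X by rewrite divr_gt0.
have l2 : ln (3 / 2) <= ln (G / X).
  by rewrite ler_ln ?posrE ?divr_gt0// ler_pdivlMr//; lra.
pose y := ln (G / X) / ln (3 / 2).
have y1 : 1 <= y by rewrite ler_pdivlMr// mul1r.
pose k := Num.Def.trunc y.
have /truncn_itv/andP[ky yk] : 0 <= y by lra.
have k1 : (0 < k)%N by rewrite -(ltr_nat R) -(ltrD2r 1) natr1; lra.
have k1' : 1 <= k%:R :> R by rewrite ler1n.
exists X, k; split => //; first by lra.
  rewrite -ler_pdivlMr// -ler_ln ?posrE ?exprn_gt0 ?divr_gt0//.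
  by rewrite lnXn ?divr_gt0// -[ln _ *+ k]mulr_natl -ler_pdivlMr.
have lk : ln (G / X) <= k%:R.
  move: yk; rewrite -natr1 /y -/k ltr_pdivrMr// => yk.
  have : (k%:R + 1) * ln (3 / 2) <= (k%:R + 1) * 2^-1 :> R by rewrite ler_wpM2l//; lra.
  by lra.
have l3 : ln 2 <= 1 :> R.
  by have := @le_ln1Dx R 1; rewrite (_ : 1 + 1 = 2); [apply; lra|ring].
have lmG : ln m%:R <= 1 + ln G.
  have : ln m%:R <= ln (2 * G) by rewrite ler_ln ?posrE ?mulr_gt0.
  by rewrite lnM ?posrE//; lra.
have F0 : 0 < F by lra.
rewrite ln_div ?posrE// -/F; move: lk; rewrite ln_div ?posrE//.
rewrite /X maxEle; case: ifP => _ lk; last by lra.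
have lm : ln m%:R = 4 * ln q by rewrite -q4 lnXn// mulr_natl.
have lF : 0 <= ln F by rewrite ln_ge0.
(* Here [ln m / 4 <= 1 + k <= 2 * k], whence the factor 8. *)
by move: lk; rewrite lnXn// -[_ *+ 3]mulr_natl; lra.
Qed.

Unset Implicit Arguments.

Theorem theorem2 (R : realType) :
  exists C0 C2 C3 : R, [/\ 0 < C0, 0 < C2, 0 < C3 &
    forall m n r : nat,
      C0 <= n%:R -> (n < m)%N -> (m < 2 * n)%N ->
      let delta : R := n%:R / m%:R in
      (m < r)%N -> (1 / (1 - delta)) `^ C2 * n%:R <= r%:R ->
      1 / C3 * n%:R * ln n%:R ^+ 2 * ln (1 / (1 - delta)) <= (chi n m r)%:R].
Proof.
have [L0 [c [c0 H]]] := phases R.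
(* The summand 100 takes care of roundings, the other one of [L0 <= ln m]. As [m < 2 * n], the base
   [1 / (1 - delta)] is at least 2, so the exponent 6 gives [64 * n <= r], room for keys at distance
   64. The 8 comes from [log_phases]. *)
exists (expR L0 + 100), 6, (8 / c).
have e0 := expR_gt0 L0.
split; [lra|lra|by rewrite divr_gt0|].
move=> m n r Cn nm m2n delta mr rC.
have n100 : (100 <= n)%N by rewrite -(ler_nat R); lra.
have n0 : 0 < n%:R :> R by lra.
have m0 : 0 < m%:R :> R by rewrite ltr0n (leq_trans _ nm).
have nmR : n%:R < m%:R :> R by rewrite ltr_nat.
have m2nR : m%:R < 2 * n%:R :> R by rewrite -natrM ltr_nat.
have FE : (m - n)%:R = m%:R - n%:R :> R by rewrite natrB// ltnW.
have ratio : 1 / (1 - delta) = m%:R / (m - n)%:R.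
  by rewrite /delta FE; field; rewrite ?subr_eq0 ?gt_eqF.
have F0 : 0 < (m - n)%:R :> R by rewrite FE; lra.
have ratio2 : 2 <= m%:R / (m - n)%:R :> R by rewrite ler_pdivlMr// FE; lra.
have r64 : (64 * n <= r)%N.
  rewrite -(ler_nat R); apply: le_trans rC; rewrite natrM ler_wpM2r// ratio.
  rewrite powR_mulrn; last by lra.
  have : 2 ^+ 6 <= (m%:R / (m - n)%:R) ^+ 6 :> R by rewrite ler_pXn2r ?nnegrE//; lra.
  by apply: le_trans; rewrite -natrX ler_nat.
have Lm : L0 <= ln m%:R.
  by rewrite -[leLHS]expRK ler_ln ?posrE//; lra.
have [X [k [qX X3 FX kX lnk]]] := @log_phases R m n n100 nm m2n.
rewrite ratio; apply: chi_lower_bound.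
- by rewrite (ltnW nm) (leq_trans _ n100).
- exact: leq_ltn_trans mr.
move=> Lz LC lg.
(* The game opens with half of the keys, [n./2] multiples of 64 from 0 on. *)
pose N0 := (n./2).-1.
pose h := grid N0.
have hn : size h = n./2 by rewrite size_map size_iota /N0; move: n100; clear; lia.
have gh : good r n h.
  by apply: grid_good; rewrite /N0; move: n100 r64 nm mr; clear; lia.
have rhi : (64 * N0)%N \in h by apply: mem_grid.
have rlo : 0%N \in h by rewrite -[0%N](muln0 64); apply: mem_grid.
have ws : well_spread 64 m 0 (64 * N0) h (Lz h).
  split=> //; [by case/and3P: gh|exact: lz_incr lg _ gh| |].
    by move=> a b; apply: grid_spacing.
  by move=> j; apply: lz_range lg _ _ gh.
have hG : (size h + (m - n./2) = m)%N by rewrite hn; move: nm; clear; lia.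
have Nh : (0 < N0 < size h)%N by rewrite hn /N0; move: n100; clear; lia.
have mN : (m <= 5 * N0)%N by rewrite /N0; move: n100 m2n; clear; lia.
have hc : ((size h).-1 <= cnt h 0 (64 * N0))%N.
  by rewrite hn; have := grid_spacing rlo rhi (leq0n _); rewrite subn0 leq_mul2l.
have [s [gs le]] := H m n r N0 Lz LC X k h (m - n./2)%N lg Lm (ltnW nm) mN Nh hG qX X3 FX kX gh ws hc.
have nr : (n <= r)%N by move: r64; clear; lia.
have [h' [gh' sh' le']] := good_complete lg nr gs.
exists h'; split => //.
have lnn0 : 0 <= ln n%:R :> R by rewrite ln_ge0// ler1n (leq_trans _ n100).
have lnnm : ln n%:R <= ln m%:R :> R by rewrite ler_ln ?posrE// ltW.
have LCle : (LC (s ++ h))%:R <= (LC h')%:R :> R by rewrite ler_nat.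
apply: le_trans LCle; apply: le_trans le; apply: (@le_trans _ _ (k%:R * (c * (m%:R * ln m%:R ^+ 2)))); last first.
  by rewrite lerDr.
have -> : 1 / (8 / c) * n%:R * ln n%:R ^+ 2 * ln (m%:R / (m - n)%:R) =
  c / 8 * (n%:R * ln n%:R ^+ 2) * ln (m%:R / (m - n)%:R) by field; rewrite gt_eqF.
have -> : k%:R * (c * (m%:R * ln m%:R ^+ 2)) = c / 8 * (m%:R * ln m%:R ^+ 2) * (8 * k%:R).
  by field.
apply: ler_pM lnk.
- by rewrite mulr_ge0 ?mulr_ge0 ?exprn_ge0 ?divr_ge0// ltW.
- by rewrite ln_ge0//; lra.
rewrite ler_wpM2l ?divr_ge0 ?(ltW c0)//.
by apply: ler_pM; rewrite ?exprn_ge0// ?(ltW nmR)// ler_pXn2r ?nnegrE// (le_trans lnn0).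
Qed.
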